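(* Let $D$ be a difference operator on a connected cocommutative Hopf algebra $H$. Let $\bar D$ be the difference operator on $U(P(H))$ extending $D|_{P(H)}$. Then there is an isomorphism from the difference operator $\bar D$ on $U(P(H))$ to the difference operator $D$ on $H$; that is, there is a Hopf algebra isomorphism $\varphi:U(P(H))\to H$ with $\varphi\circ\bar D=D\circ\varphi$.
   Context: Everything is over a field $\mathbf{k}$ of characteristic $0$. Sweedler notation: $\Delta(x)=x_1\otimes x_2$, $(\Delta\otimes \mathrm{id})\Delta(x)=x_1\otimes x_2\otimes x_3$. $P(H)=\{c\in H:\Delta(c)=c\otimes 1+1\otimes c\}$ is the Lie algebra of primitive elements and $U(\cdot)$ the universal enveloping algebra. A difference operator on a Hopf algebra $H$ is a coalgebra homomorphism $D:H\to H$ with $D(xy)=D(x_1)x_2D(y)S(x_3)$ for all $x,y\in H$. A difference operator on a Lie algebra $\mathfrak g$ is a linear map $d:\mathfrak g\to\mathfrak g$ with $d([x,y])=[d(x),y]+[x,d(y)]+[d(x),d(y)]$. A difference operator $D$ on $H$ restricts to a difference operator on the Lie algebra $P(H)$. Any difference operator $d$ on a Lie algebra $\mathfrak g$ extends to a unique difference operator $\bar d$ on the Hopf algebra $U(\mathfrak g)$, given by $\bar d(x_1\cdots x_n)=(d(x_1)+\mathrm{ad}_{x_1})\cdots(d(x_n)+\mathrm{ad}_{x_n})(1)$ for $x_i\in\mathfrak g$, where $d(x_k)$ acts by left multiplication and $\mathrm{ad}_x(u)=xu-ux$ on $U(\mathfrak g)$. Here $\bar D$ denotes the extension of $d=D|_{P(H)}$.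 *)

(* Defs.v *)
From HB Require Import structures.
From mathcomp Require Import all_boot all_order all_algebra sesquilinear.
From mathcomp.classical Require Import boolp.

Set Implicit Arguments.
Unset Strict Implicit.
Unset Printing Implicit Defensive.

Import GRing.Theory.
Local Open Scope ring_scope.
Local Open Scope quotient_scope.

Declare Scope hopf_scope.
Delimit Scope hopf_scope with hopf.
Reserved Notation "v \ox w" (at level 40, left associativity).

(* V ⊗ W is the vector space presented by the generators v ⊗ w and the
    relations making ⊗ bilinear: formal linear combinations modulo the least
    congruence containing the vector space axioms and bilinearity. *)
Section TensorTerms.
Variables (k : fieldType) (V W : lmodType k).

Inductive tterm : Type :=
| TPure of V & W
| TZero
| TAdd of tterm & tterm
| TScale of k & tterm.

Inductive teq : tterm -> tterm -> Prop :=
| teq_refl s : teq s s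
| teq_sym s t : teq s t -> teq t s
| teq_trans s t u : teq s t -> teq t u -> teq s u
| teq_add s s' t t' : teq s s' -> teq t t' -> teq (TAdd s t) (TAdd s' t')
| teq_scale a s s' : teq s s' -> teq (TScale a s) (TScale a s')
| teq_addA s t u : teq (TAdd s (TAdd t u)) (TAdd (TAdd s t) u)
| teq_addC s t : teq (TAdd s t) (TAdd t s)
| teq_add0 s : teq (TAdd TZero s) s
| teq_addN s : teq (TAdd (TScale (-1) s) s) TZero
| teq_scaleA a b s : teq (TScale a (TScale b s)) (TScale (a * b) s)
| teq_scale1 s : teq (TScale 1 s) s
| teq_scaleDr a s t :
    teq (TScale a (TAdd s t)) (TAdd (TScale a s) (TScale a t))
| teq_scaleDl a b s :
    teq (TScale (a + b) s) (TAdd (TScale a s) (TScale b s))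
| teq_pureDl v v' w : teq (TPure (v + v') w) (TAdd (TPure v w) (TPure v' w))
| teq_pureDr v w w' : teq (TPure v (w + w')) (TAdd (TPure v w) (TPure v w'))
| teq_pureZl a v w : teq (TPure (a *: v) w) (TScale a (TPure v w))
| teq_pureZr a v w : teq (TPure v (a *: w)) (TScale a (TPure v w)).

HB.instance Definition _ := gen_eqMixin tterm.
HB.instance Definition _ := gen_choiceMixin tterm.

Definition teqb (s t : tterm) : bool := `[< teq s t >].

Lemma teqb_refl : reflexive teqb.
Proof. by move=> s; apply/asboolP; apply: teq_refl. Qed.
Lemma teqb_sym : symmetric teqb.
Proof.
by move=> s t; apply/idP/idP => /asboolP h; apply/asboolP; apply: teq_sym.
Qed.
Lemma teqb_trans : transitive teqb.
Proof.
move=> t s u /asboolP h1 /asboolP h2; apply/asboolP; exact: teq_trans h1 h2.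
Qed.

Canonical teqb_equiv := EquivRel teqb teqb_refl teqb_sym teqb_trans.

Definition tensor := {eq_quot teqb_equiv}.
HB.instance Definition _ := Choice.on tensor.
HB.instance Definition _ := EqQuotient.on tensor.

Lemma tpi_eq s t : teq s t -> \pi_tensor s = \pi_tensor t.
Proof. by move=> h; apply/eqmodP; apply/asboolP. Qed.
Lemma teq_pi s t : \pi_tensor s = \pi_tensor t -> teq s t.
Proof. by move/eqmodP/asboolP. Qed.
Lemma teq_repr s : teq (repr (\pi_tensor s)) s.
Proof. by apply: teq_pi; rewrite reprK. Qed.

Definition tpure (v : V) (w : W) : tensor := \pi_tensor (TPure v w).
Definition tzero : tensor := \pi_tensor TZero.
Definition tadd : tensor -> tensor -> tensor :=
  locked (fun s t => \pi_tensor (TAdd (repr s) (repr t))).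
Definition tscale : k -> tensor -> tensor :=
  locked (fun a s => \pi_tensor (TScale a (repr s))).
Definition topp (s : tensor) : tensor := tscale (-1) s.

Lemma taddE s t : tadd (\pi_tensor s) (\pi_tensor t) = \pi_tensor (TAdd s t).
Proof. by rewrite /tadd -lock; apply: tpi_eq; apply: teq_add; apply: teq_repr. Qed.
Lemma tscaleE a s : tscale a (\pi_tensor s) = \pi_tensor (TScale a s).
Proof. by rewrite /tscale -lock; apply: tpi_eq; apply: teq_scale; apply: teq_repr. Qed.

Lemma taddA : associative tadd.
Proof.
elim/quotW=> s; elim/quotW=> t; elim/quotW=> u.
by rewrite !taddE; apply: tpi_eq; apply: teq_addA.
Qed.
Lemma taddC : commutative tadd.
Proof.
elim/quotW=> s; elim/quotW=> t; rewrite !taddE; apply: tpi_eq; exact: teq_addC.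
Qed.
Lemma tadd0 : left_id tzero tadd.
Proof. elim/quotW=> s; rewrite taddE; apply: tpi_eq; exact: teq_add0. Qed.
Lemma taddN : left_inverse tzero topp tadd.
Proof.
elim/quotW=> s; rewrite /topp tscaleE taddE; apply: tpi_eq; exact: teq_addN.
Qed.

HB.instance Definition _ := GRing.isZmodule.Build tensor taddA taddC tadd0 taddN.

Lemma tscaleA a b s : tscale a (tscale b s) = tscale (a * b) s.
Proof.
by elim/quotW: s => s; rewrite !tscaleE; apply: tpi_eq; apply: teq_scaleA.
Qed.
Lemma tscale1 : left_id 1 tscale.
Proof. elim/quotW=> s; rewrite !tscaleE; apply: tpi_eq; exact: teq_scale1. Qed.
Lemma tscaleDr : right_distributive tscale +%R.
Proof.
move=> a; elim/quotW=> s; elim/quotW=> t.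
rewrite -[LHS]/(tscale a (tadd _ _)) -[RHS]/(tadd _ _).
by rewrite !(tscaleE, taddE); apply: tpi_eq; apply: teq_scaleDr.
Qed.
Lemma tscaleDl s : {morph tscale^~ s : a b / a + b}.
Proof.
move=> a b; elim/quotW: s => s; rewrite -[RHS]/(tadd _ _).
by rewrite !(tscaleE, taddE); apply: tpi_eq; apply: teq_scaleDl.
Qed.

HB.instance Definition _ := GRing.Zmodule_isLmodule.Build k tensor
  tscaleA tscale1 tscaleDr tscaleDl.

End TensorTerms.

Arguments tensor {k} V W.
Notation "v \ox w" := (tpure v w) : hopf_scope.
Local Open Scope hopf_scope.

Section TensorTheory.
Variables (k : fieldType) (V W : lmodType k).

Lemma tpureDl (v v' : V) (w : W) : (v + v') \ox w = v \ox w + v' \ox w.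
Proof.
by rewrite -[RHS]/(tadd _ _) taddE; apply: tpi_eq; apply: teq_pureDl.
Qed.
Lemma tpureDr (v : V) (w w' : W) : v \ox (w + w') = v \ox w + v \ox w'.
Proof.
by rewrite -[RHS]/(tadd _ _) taddE; apply: tpi_eq; apply: teq_pureDr.
Qed.
Lemma tpureZl a (v : V) (w : W) : (a *: v) \ox w = a *: (v \ox w).
Proof.
by rewrite -[RHS]/(tscale _ _) tscaleE; apply: tpi_eq; apply: teq_pureZl.
Qed.
Lemma tpureZr a (v : V) (w : W) : v \ox (a *: w) = a *: (v \ox w).
Proof.
by rewrite -[RHS]/(tscale _ _) tscaleE; apply: tpi_eq; apply: teq_pureZr.
Qed.
Lemma tpure0l (w : W) : (0 : V) \ox w = 0.
Proof. by rewrite -(scale0r (0 : V)) tpureZl scale0r. Qed.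
Lemma tpure0r (v : V) : v \ox (0 : W) = 0.
Proof. by rewrite -(scale0r (0 : W)) tpureZr scale0r. Qed.

Lemma tpureBl (v v' : V) (w : W) : (v - v') \ox w = v \ox w - v' \ox w.
Proof. by rewrite -scaleN1r tpureDl tpureZl scaleN1r. Qed.
Lemma tpureBr (v : V) (w w' : W) : v \ox (w - w') = v \ox w - v \ox w'.
Proof. by rewrite -scaleN1r tpureDr tpureZr scaleN1r. Qed.

Lemma tpure_bilinear : bilinear_for *:%R *:%R (@tpure k V W).
Proof.
by split=> [w a u v|v a u w] /=; rewrite ?tpureDl ?tpureZl ?tpureDr ?tpureZr.
Qed.

Lemma tensor_ind (P : tensor V W -> Prop) :
  (forall v w, P (v \ox w)) -> (forall s t, P s -> P t -> P (s + t)) ->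
  forall t, P t.
Proof.
move=> Pp Pa; elim/quotW=> t.
suff: forall b, P (b *: (\pi_(tensor V W) t)) by move/(_ 1); rewrite scale1r.
elim: t => [v w||s IHs t IHt|a s IHs] b.
- by rewrite -[X in b *: X]/(v \ox w) -tpureZl; apply: Pp.
- by rewrite -[X in b *: X]/(0 : tensor V W) scaler0 -(tpure0l 0); apply: Pp.
- by rewrite -taddE -[X in b *: X]/(_ + _) scalerDr; apply: Pa.
by rewrite -tscaleE -[X in b *: X]/(a *: _) scalerA.
Qed.

Variable (X : lmodType k).

Fixpoint teval (f : V -> W -> X) (t : tterm V W) : X :=
  match t with
  | TPure v w => f v w
  | TZero => 0
  | TAdd s t => teval f s + teval f t
  | TScale a s => a *: teval f s
  end.

(* For bilinear f, the linear map on V ⊗ W that f induces (see tlift_pure and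
   tlift_linear); meaningless for other f. *)
Definition tlift (f : V -> W -> X) (t : tensor V W) : X := teval f (repr t).

Section Bilinear.
Variables (f : V -> W -> X) (hf : bilinear_for *:%R *:%R f).

Lemma bilinDl u v w : f (u + v) w = f u w + f v w.
Proof. by have := hf.1 w 1 u v; rewrite /= !scale1r. Qed.
Lemma bilinDr v w w' : f v (w + w') = f v w + f v w'.
Proof. by have := hf.2 v 1 w w'; rewrite /= !scale1r. Qed.
Lemma bilin0l w : f 0 w = 0.
Proof. by apply: (@addrI _ (f 0 w)); rewrite -bilinDl !addr0. Qed.
Lemma bilin0r v : f v 0 = 0.
Proof. by apply: (@addrI _ (f v 0)); rewrite -bilinDr !addr0. Qed.
Lemma bilinZl a v w : f (a *: v) w = a *: f v w.
Proof. by have := hf.1 w a v 0; rewrite /= !addr0 bilin0l addr0. Qed.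
Lemma bilinZr a v w : f v (a *: w) = a *: f v w.
Proof. by have := hf.2 v a w 0; rewrite /= !addr0 bilin0r addr0. Qed.

Lemma teval_eq s t : teq s t -> teval f s = teval f t.
Proof.
elim=> //=.
- by move=> s0 t0 u _ -> _ ->.
- by move=> s0 s' t0 t' _ -> _ ->.
- by move=> a s0 s' _ ->.
- by move=> s0 t0 u; rewrite addrA.
- by move=> s0 t0; rewrite addrC.
- by move=> s0; rewrite add0r.
- by move=> s0; rewrite scaleN1r addNr.
- by move=> a b s0; rewrite scalerA.
- by move=> s0; rewrite scale1r.
- by move=> a s0 t0; rewrite scalerDr.
- by move=> a b s0; rewrite scalerDl.
- exact: bilinDl.
- exact: bilinDr.
- exact: bilinZl.
exact: bilinZr.
Qed.

Lemma tlift_pi t : tlift f (\pi_(tensor V W) t) = teval f t.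
Proof. exact/teval_eq/teq_repr. Qed.

Lemma tlift_pure v w : tlift f (v \ox w) = f v w.
Proof. exact: tlift_pi. Qed.

Lemma tlift_linear : linear (tlift f).
Proof.
move=> a; elim/quotW=> s; elim/quotW=> t.
by rewrite -[X in tlift f X]/(tadd (tscale _ _) _) tscaleE taddE !tlift_pi.
Qed.

Lemma tliftD s t : tlift f (s + t) = tlift f s + tlift f t.
Proof. by have := tlift_linear 1 s t; rewrite !scale1r. Qed.
Lemma tlift0 : tlift f 0 = 0.
Proof. by apply: (@addrI _ (tlift f 0)); rewrite -tliftD !addr0. Qed.
Lemma tliftZ a s : tlift f (a *: s) = a *: tlift f s.
Proof. by have := tlift_linear a s 0; rewrite !addr0 tlift0 addr0. Qed.

End Bilinear.
End TensorTheory.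

Lemma linear_eq_tensor (k : fieldType) (V W X : lmodType k)
    (f g : tensor V W -> X) :
  linear f -> linear g -> (forall v w, f (v \ox w) = g (v \ox w)) -> f =1 g.
Proof.
move=> hf hg e; apply: tensor_ind => // s t es et.
by have := hf 1 s t; have := hg 1 s t; rewrite !scale1r es et => -> ->.
Qed.

Section TensorMaps.
Variable k : fieldType.

Definition tmap (V V' W W' : lmodType k) (f : V -> V') (g : W -> W') :
  tensor V W -> tensor V' W' := tlift (fun v w => f v \ox g w).

Definition tswap (V W : lmodType k) : tensor V W -> tensor W V :=
  tlift (fun v w => w \ox v).

Definition tassoc (U V W : lmodType k) :
  tensor (tensor U V) W -> tensor U (tensor V W) :=
  tlift (fun uv w => tlift (fun u v => u \ox (v \ox w)) uv).

(* Componentwise product on V ⊗ W of bilinear products m on V and n on W. *)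
Definition tmul (V W : lmodType k) (m : V -> V -> V) (n : W -> W -> W)
    (s t : tensor V W) : tensor V W :=
  tlift (fun v w => tlift (fun v' w' => m v v' \ox n w w') t) s.

End TensorMaps.

Section TensorMapsTheory.
Variable k : fieldType.

Lemma bilinI (V W X : lmodType k) (f : V -> W -> X) :
  (forall w, linear (f^~ w)) -> (forall v, linear (f v)) ->
  bilinear_for *:%R *:%R f.
Proof. by move=> h1 h2; split. Qed.

Lemma linD (V X : lmodType k) (f : V -> X) :
  linear f -> forall u v, f (u + v) = f u + f v.
Proof. by move=> h u v; have := h 1 u v; rewrite !scale1r. Qed.
Lemma lin0 (V X : lmodType k) (f : V -> X) : linear f -> f 0 = 0.
Proof.
by move=> h; apply: (@addrI _ (f 0)); rewrite -(linD h) !addr0.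
Qed.
Lemma linZ (V X : lmodType k) (f : V -> X) :
  linear f -> forall a u, f (a *: u) = a *: f u.
Proof. by move=> h a u; have := h a u 0; rewrite (lin0 h) !addr0. Qed.
Lemma linB (V X : lmodType k) (f : V -> X) :
  linear f -> forall u v, f (u - v) = f u - f v.
Proof.
by move=> h u v; rewrite -scaleN1r (linD h) (linZ h) scaleN1r.
Qed.

Lemma tlift_comb (V W X : lmodType k) (h f g : V -> W -> X) (a : k) t :
  (forall v w, h v w = a *: f v w + g v w) ->
  tlift h t = a *: tlift f t + tlift g t.
Proof.
move=> e; rewrite /tlift; elim: (repr t) => //= [|s -> u ->|b s ->].
- by rewrite scaler0 addr0.
- by rewrite scalerDr addrACA.
- by rewrite scalerDr !scalerA mulrC.
Qed.

Lemma eq_tlift (V W X : lmodType k) (f g : V -> W -> X) t :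
  (forall v w, f v w = g v w) -> tlift f t = tlift g t.
Proof.
by move=> e; rewrite /tlift; elim: (repr t) => //= [s -> u ->|b s ->].
Qed.

Lemma tmap_bilinear (V V' W W' : lmodType k) (f : V -> V') (g : W -> W') :
  linear f -> linear g ->
  bilinear_for *:%R *:%R (fun v w => f v \ox g w).
Proof.
move=> hf hg; apply: bilinI => [w a u v|v a w w'].
  by rewrite hf tpureDl tpureZl.
by rewrite hg tpureDr tpureZr.
Qed.

Lemma tmap_pure (V V' W W' : lmodType k) (f : V -> V') (g : W -> W') v w :
  linear f -> linear g -> tmap f g (v \ox w) = f v \ox g w.
Proof. by move=> hf hg; apply: tlift_pure; apply: tmap_bilinear. Qed.

Lemma tmap_linear (V V' W W' : lmodType k) (f : V -> V') (g : W -> W') :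
  linear f -> linear g -> linear (tmap f g).
Proof. by move=> hf hg; apply/tlift_linear/tmap_bilinear. Qed.

Lemma tswap_bilinear (V W : lmodType k) :
  bilinear_for *:%R *:%R (fun (v : V) (w : W) => w \ox v).
Proof.
apply: bilinI => [w a u v|v a w w']; first by rewrite tpureDr tpureZr.
by rewrite tpureDl tpureZl.
Qed.
Lemma tswap_pure (V W : lmodType k) (v : V) (w : W) :
  tswap (v \ox w) = w \ox v.
Proof. exact/tlift_pure/tswap_bilinear. Qed.
Lemma tswap_linear (V W : lmodType k) : linear (@tswap k V W).
Proof. exact/tlift_linear/tswap_bilinear. Qed.

Lemma tassoc_bilinear1 (U V W : lmodType k) (w : W) :
  bilinear_for *:%R *:%R (fun (u : U) (v : V) => u \ox (v \ox w)).
Proof.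
apply: bilinI => [v a u u'|u a v v']; first by rewrite tpureDl tpureZl.
by rewrite tpureDl tpureZl tpureDr tpureZr.
Qed.
Lemma tassoc_bilinear (U V W : lmodType k) :
  bilinear_for *:%R *:%R (fun (uv : tensor U V) (w : W) =>
    tlift (fun u v => u \ox (v \ox w)) uv).
Proof.
apply: bilinI => [w|uv a w w']; first exact/tlift_linear/tassoc_bilinear1.
by apply: tlift_comb => u v; rewrite tpureDr tpureZr tpureDr tpureZr.
Qed.
Lemma tassoc_pure (U V W : lmodType k) (u : U) (v : V) (w : W) :
  tassoc (u \ox v \ox w) = u \ox (v \ox w).
Proof.
rewrite [LHS](tlift_pure (@tassoc_bilinear U V W)) /=.
by rewrite (tlift_pure (@tassoc_bilinear1 U V W w)).
Qed.
Lemma tassoc_linear (U V W : lmodType k) : linear (@tassoc k U V W).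
Proof. exact/tlift_linear/tassoc_bilinear. Qed.

Section Mul.
Variables (V W : lmodType k) (m : V -> V -> V) (n : W -> W -> W).
Hypotheses (hm : bilinear_for *:%R *:%R m) (hn : bilinear_for *:%R *:%R n).

Lemma tmul_bilinear1 (v : V) (w : W) :
  bilinear_for *:%R *:%R (fun v' w' => m v v' \ox n w w').
Proof. by apply: tmap_bilinear; [apply: hm.2|apply: hn.2]. Qed.
Lemma tmul_bilinear2 t : bilinear_for *:%R *:%R
  (fun v w => tlift (fun v' w' => m v v' \ox n w w') t).
Proof.
apply: bilinI => [w a v v'|v a w w']; apply: tlift_comb => x y.
  by rewrite [m _ _](hm.1 _ _) tpureDl tpureZl.
by rewrite [n _ _](hn.1 _ _) tpureDr tpureZr.
Qed.
Lemma tmul_pure v w v' w' :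
  tmul m n (v \ox w) (v' \ox w') = m v v' \ox n w w'.
Proof.
rewrite [LHS](tlift_pure (tmul_bilinear2 _)) /=.
by rewrite (tlift_pure (tmul_bilinear1 v w)).
Qed.
Lemma tmul_bilinear : bilinear_for *:%R *:%R (tmul m n).
Proof.
apply: bilinI => [t|s a t t']; first exact/tlift_linear/tmul_bilinear2.
by apply: tlift_comb => v w; apply/tlift_linear/tmul_bilinear1.
Qed.
Lemma tmulA : associative m -> associative n -> associative (tmul m n).
Proof.
move=> mA nA; have D := bilinDl tmul_bilinear; have E := bilinDr tmul_bilinear.
elim/tensor_ind=> [a b|s s' IH IH'] t u; last by rewrite !D IH IH'.
elim/tensor_ind: t => [c d|s s' IH IH']; last by rewrite !(D, E) IH IH'.
elim/tensor_ind: u => [e f|s s' IH IH']; last by rewrite !E IH IH'.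
by rewrite !tmul_pure mA nA.
Qed.
Lemma tmul1l e f : left_id e m -> left_id f n -> left_id (e \ox f) (tmul m n).
Proof.
move=> me nf; elim/tensor_ind=> [a b|s t IHs IHt].
  by rewrite tmul_pure me nf.
by rewrite (bilinDr tmul_bilinear) IHs IHt.
Qed.
Lemma tmul1r e f : right_id e m -> right_id f n -> right_id (e \ox f) (tmul m n).
Proof.
move=> me nf; elim/tensor_ind=> [a b|s t IHs IHt].
  by rewrite tmul_pure me nf.
by rewrite (bilinDl tmul_bilinear) IHs IHt.
Qed.
End Mul.

Lemma tmap_tmul (V W V' W' : lmodType k) (m : V -> V -> V) (n : W -> W -> W)
    (m' : V' -> V' -> V') (n' : W' -> W' -> W') (f : V -> V') (g : W -> W') s t :
  bilinear_for *:%R *:%R m -> bilinear_for *:%R *:%R n ->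
  bilinear_for *:%R *:%R m' -> bilinear_for *:%R *:%R n' ->
  linear f -> linear g ->
  {morph f : x y / m x y >-> m' x y} -> {morph g : x y / n x y >-> n' x y} ->
  tmap f g (tmul m n s t) = tmul m' n' (tmap f g s) (tmap f g t).
Proof.
move=> hm hn hm' hn' hf hg fM gM.
have T := linD (tmap_linear hf hg).
have D := bilinDl (tmul_bilinear hm hn); have E := bilinDr (tmul_bilinear hm hn).
have D' := bilinDl (tmul_bilinear hm' hn').
have E' := bilinDr (tmul_bilinear hm' hn').
elim/tensor_ind: s => [a b|s s' IH IH']; last by rewrite D !T D' IH IH'.
elim/tensor_ind: t => [c d|s s' IH IH']; last by rewrite E !T E' IH IH'.
by rewrite tmul_pure // !tmap_pure // tmul_pure // fM gM.
Qed.

Lemma tassoc_tmul (U V W : lmodType k) (l : U -> U -> U) (m : V -> V -> V)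
    (n : W -> W -> W) s t :
  bilinear_for *:%R *:%R l -> bilinear_for *:%R *:%R m ->
  bilinear_for *:%R *:%R n ->
  tassoc (tmul (tmul l m) n s t) = tmul l (tmul m n) (tassoc s) (tassoc t).
Proof.
move=> hl hm hn.
have hlm := tmul_bilinear hl hm; have hmn := tmul_bilinear hm hn.
have T := linD (@tassoc_linear U V W).
have D := bilinDl (tmul_bilinear hlm hn); have E := bilinDr (tmul_bilinear hlm hn).
have D' := bilinDl (tmul_bilinear hl hmn).
have E' := bilinDr (tmul_bilinear hl hmn).
elim/tensor_ind: s => [uv w|s s' IH IH']; last by rewrite D !T D' IH IH'.
elim/tensor_ind: uv => [u v|s s' IH IH']; last first.
  by rewrite !tpureDl D !T D' IH IH'.
elim/tensor_ind: t => [uv' w'|s s' IH IH']; last by rewrite E !T E' IH IH'.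
elim/tensor_ind: uv' => [u' v'|s s' IH IH']; last first.
  by rewrite !tpureDl E !T E' IH IH'.
by rewrite !(tmul_pure, tassoc_pure).
Qed.

End TensorMapsTheory.

Section TensorAlgebra.
Variable k : fieldType.

Lemma mulr_bilinear (A : algType k) : bilinear_for *:%R *:%R (@GRing.mul A).
Proof.
apply: bilinI => [w a u v|v a w w'] /=; first by rewrite mulrDl scalerAl.
by rewrite mulrDr scalerAr.
Qed.
Variables A B : algType k.

Let mulb := tmul_bilinear (@mulr_bilinear A) (@mulr_bilinear B).

HB.instance Definition _ := GRing.Zmodule_isPzRing.Build (tensor A B)
  (tmulA (@mulr_bilinear A) (@mulr_bilinear B) (@mulrA A) (@mulrA B))
  (tmul1l (@mulr_bilinear A) (@mulr_bilinear B) (@mul1r A) (@mul1r B))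
  (tmul1r (@mulr_bilinear A) (@mulr_bilinear B) (@mulr1 A) (@mulr1 B))
  (bilinDl mulb) (bilinDr mulb).

Lemma tensor_mulE : @GRing.mul (tensor A B) = tmul *%R *%R.
Proof. by []. Qed.
Lemma tensor_oneE : (1 : tensor A B) = 1 \ox 1.
Proof. by []. Qed.
Lemma tpureM (a a' : A) (b b' : B) :
  (a \ox b) * (a' \ox b') = (a * a') \ox (b * b').
Proof. exact: tmul_pure (@mulr_bilinear A) (@mulr_bilinear B) _ _ _ _. Qed.
Lemma tensor_scalerAl (a : k) (s t : tensor A B) : a *: (s * t) = a *: s * t.
Proof. by rewrite tensor_mulE (bilinZl mulb). Qed.
Lemma tensor_scalerAr (a : k) (s t : tensor A B) : a *: (s * t) = s * (a *: t).
Proof. by rewrite tensor_mulE (bilinZr mulb). Qed.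

End TensorAlgebra.

HB.mixin Record Lmodule_isCoalgebra (k : fieldType) C of GRing.Lmodule k C := {
  comul : C -> tensor C C;
  counit : C -> k;
  comul_linear : linear comul;
  counit_linear : scalar counit;
  comulA : forall x, tassoc (tmap comul id (comul x)) = tmap id comul (comul x);
  counitl : forall x, tlift (fun a b => counit a *: b) (comul x) = x;
  counitr : forall x, tlift (fun a b => counit b *: a) (comul x) = x
}.

#[short(type="coalgType")]
HB.structure Definition Coalgebra (k : fieldType) :=
  {C of GRing.Lmodule k C & Lmodule_isCoalgebra k C}.

HB.mixin Record Algebra_isBialgebra (k : fieldType) H
    of GRing.Algebra k H & Lmodule_isCoalgebra k H := {
  comul1 : comul (1 : H) = 1;
  comulM : {morph (comul : H -> tensor H H) : x y / x * y};
  counit1 : counit (1 : H) = 1;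
  counitM : {morph (counit : H -> k) : x y / x * y}
}.

#[short(type="bialgType")]
HB.structure Definition Bialgebra (k : fieldType) :=
  {H of GRing.Algebra k H & Lmodule_isCoalgebra k H & Algebra_isBialgebra k H}.

HB.mixin Record Bialgebra_isHopf (k : fieldType) H of Bialgebra k H := {
  antipode : H -> H;
  antipode_linear : linear antipode;
  antipodel : forall x : H,
    tlift (fun a b => antipode a * b) (comul x) = (counit x)%:A;
  antipoder : forall x : H,
    tlift (fun a b => a * antipode b) (comul x) = (counit x)%:A
}.

#[short(type="hopfAlgType")]
HB.structure Definition HopfAlgebra (k : fieldType) :=
  {H of Bialgebra k H & Bialgebra_isHopf k H}.

Section HopfNotions.
Variable k : fieldType.

Definition cocommutative (C : coalgType k) :=
  forall x : C, tswap (comul x) = comul x.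

Definition coalgebra_hom (C E : coalgType k) (f : C -> E) :=
  [/\ linear f,
      forall x, comul (f x) = tmap f f (comul x) &
      forall x, counit (f x) = counit x].

Definition hopf_hom (H K : hopfAlgType k) (f : H -> K) :=
  [/\ coalgebra_hom f, f 1 = 1, {morph f : x y / x * y} &
      {morph f : x / antipode x}].

Definition hopf_isomorphism (H K : hopfAlgType k) (f : H -> K) :=
  hopf_hom f /\ bijective f.

(* Connectedness: the coradical, i.e. the sum of all simple subcoalgebras, is
    the line k·1. *)
Section Coradical.
Variable C : coalgType k.

Definition subspace (E : C -> Prop) :=
  E 0 /\ forall (a : k) x y, E x -> E y -> E (a *: x + y).

(* E ⊗ E is identified with its image in C ⊗ C. *)
Definition subcoalgebra (E : C -> Prop) :=
  subspace E /\
  forall x, E x -> exists2 s : seq (C * C),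
    forall p, p \in s -> E p.1 /\ E p.2 &
    comul x = \sum_(p <- s) p.1 \ox p.2.

Definition simple_subcoalgebra (E : C -> Prop) :=
  [/\ subcoalgebra E, exists2 x, E x & x <> 0 &
      forall F : C -> Prop, subcoalgebra F -> (forall x, F x -> E x) ->
        (forall x, F x -> x = 0) \/ (forall x, E x -> F x)].

Definition coradical (x : C) :=
  exists2 s : seq C,
    forall y, y \in s -> exists2 E, simple_subcoalgebra E & E y &
    x = \sum_(y <- s) y.
End Coradical.

Definition connected (H : bialgType k) :=
  forall x : H, coradical x <-> exists a : k, x = a%:A.

(* D(xy) = D(x_1) x_2 D(y) S(x_3), with
   (Δ ⊗ id) Δ(x) = (x_1 ⊗ x_2) ⊗ x_3. *)
Definition difference_operator (H : hopfAlgType k) (D : H -> H) :=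
  coalgebra_hom D /\
  forall x y, D (x * y) =
    tlift (fun x12 x3 =>
             tlift (fun x1 x2 => D x1 * x2 * D y * antipode x3) x12)
      (tmap comul id (comul x)).

End HopfNotions.

HB.mixin Record Lmodule_isLieAlgebra (k : fieldType) g of GRing.Lmodule k g := {
  lie : g -> g -> g;
  lie_bilinear : bilinear_for *:%R *:%R lie;
  liexx : forall x, lie x x = 0;
  lie_jacobi : forall x y z,
    lie x (lie y z) + lie y (lie z x) + lie z (lie x y) = 0
}.

#[short(type="lieAlgType")]
HB.structure Definition LieAlgebra (k : fieldType) :=
  {g of GRing.Lmodule k g & Lmodule_isLieAlgebra k g}.

Section Primitive.
Variables (k : fieldType) (H : bialgType k).

Definition primitive : {pred H} :=
  [pred c | comul c == c \ox 1 + 1 \ox c].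

Lemma primitiveP (c : H) :
  reflect (comul c = c \ox 1 + 1 \ox c) (c \in primitive).
Proof. exact: eqP. Qed.

Lemma primitive_submod_closed : submod_closed primitive.
Proof.
split=> [|a x y /primitiveP hx /primitiveP hy]; apply/primitiveP.
  by rewrite (lin0 comul_linear) tpure0l tpure0r addr0.
rewrite comul_linear hx hy tpureDl tpureDr tpureZl tpureZr scalerDr.
by rewrite addrACA.
Qed.
HB.instance Definition _ :=
  GRing.isSubmodClosed.Build k H primitive primitive_submod_closed.

Lemma primitive_commutator (x y : H) :
  x \in primitive -> y \in primitive -> x * y - y * x \in primitive.
Proof.
move=> /primitiveP hx /primitiveP hy; apply/primitiveP.
rewrite (linB comul_linear) !comulM hx hy !(mulrDl, mulrDr) !tpureM.
rewrite !(mul1r, mulr1) tpureBl tpureBr.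
set a := (x * y) \ox 1; set b := x \ox y; set c := y \ox x.
set d := 1 \ox (x * y); set e := (y * x) \ox 1; set f := 1 \ox (y * x).
have -> : a + b + (c + d) = (a + d) + (b + c) by rewrite [c + d]addrC addrACA.
have -> : e + c + (b + f) = (e + f) + (b + c).
  by rewrite [b + f]addrC addrACA [c + b]addrC.
by rewrite opprD addrACA subrr addr0 opprD addrACA.
Qed.

Record prim := Prim { prim_val : H; _ : prim_val \in primitive }.

HB.instance Definition _ := [isSub for prim_val].
HB.instance Definition _ := [Choice of prim by <:].
HB.instance Definition _ := [SubChoice_isSubLmodule of prim by <:].

Lemma prim_val_linear : linear prim_val.
Proof. by move=> a x y; apply: (linearP (\val : prim -> H)). Qed.

Lemma prim_comul (c : prim) :
  comul (prim_val c) = prim_val c \ox 1 + 1 \ox prim_val c.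
Proof. by apply/primitiveP; case: c. Qed.

Definition prim_lie (x y : prim) : prim :=
  Prim (primitive_commutator (valP x) (valP y)).

Lemma prim_lie_bilinear : bilinear_for *:%R *:%R prim_lie.
Proof.
apply: bilinI => [z a x y|z a x y]; apply: val_inj => /=.
  by rewrite mulrDl mulrDr scalerBr -scalerAl -scalerAr opprD addrACA.
by rewrite mulrDl mulrDr scalerBr -scalerAl -scalerAr opprD addrACA.
Qed.
Lemma prim_liexx x : prim_lie x x = 0.
Proof. by apply: val_inj; rewrite /= subrr. Qed.
Lemma prim_jacobi x y z :
  prim_lie x (prim_lie y z) + prim_lie y (prim_lie z x)
    + prim_lie z (prim_lie x y) = 0.
Proof.
apply: val_inj; rewrite /= !(mulrBl, mulrBr).
rewrite !mulrA !opprB.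
move: (prim_val x) (prim_val y) (prim_val z) => {}x {}y {}z.
rewrite !addrA.
set a := x * y * z; set b := x * z * y; set c := y * z * x.
set d := z * y * x; set e := y * x * z; set f := z * x * y.
rewrite (subrK c) (subrK f) (addrAC (a - b + d) (- e) b) (addrAC (a - b) d b).
by rewrite (subrK b) (addrAC (a + d) (- e) (- d)) (addrK d) (subrK e) subrr.
Qed.

HB.instance Definition _ := Lmodule_isLieAlgebra.Build k prim
  prim_lie_bilinear prim_liexx prim_jacobi.

End Primitive.

Arguments primitive {k H}.
Arguments prim {k} H.

(* U(g) is the associative unital algebra presented by the generators x in g
    and the relations making the generator map linear together with
    [x, y] = x y - y x: noncommutative polynomials in the elements of g modulo
    the least congruence containing the algebra axioms and these relations. *)
Section EnvelopingTerms.
Variables (k : fieldType) (g : lieAlgType k).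

Inductive uterm : Type :=
| UGen of g
| UScal of k
| UAdd of uterm & uterm
| UMul of uterm & uterm.

Inductive ueq : uterm -> uterm -> Prop :=
| ueq_refl s : ueq s s
| ueq_sym s t : ueq s t -> ueq t s
| ueq_trans s t u : ueq s t -> ueq t u -> ueq s u
| ueq_add s s' t t' : ueq s s' -> ueq t t' -> ueq (UAdd s t) (UAdd s' t')
| ueq_mul s s' t t' : ueq s s' -> ueq t t' -> ueq (UMul s t) (UMul s' t')
| ueq_addA s t u : ueq (UAdd s (UAdd t u)) (UAdd (UAdd s t) u)
| ueq_addC s t : ueq (UAdd s t) (UAdd t s)
| ueq_add0 s : ueq (UAdd (UScal 0) s) s
| ueq_addN s : ueq (UAdd (UMul (UScal (-1)) s) s) (UScal 0)
| ueq_mulA s t u : ueq (UMul s (UMul t u)) (UMul (UMul s t) u)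
| ueq_mul1l s : ueq (UMul (UScal 1) s) s
| ueq_mul1r s : ueq (UMul s (UScal 1)) s
| ueq_mulDl s t u : ueq (UMul (UAdd s t) u) (UAdd (UMul s u) (UMul t u))
| ueq_mulDr s t u : ueq (UMul s (UAdd t u)) (UAdd (UMul s t) (UMul s u))
| ueq_scalD a b : ueq (UScal (a + b)) (UAdd (UScal a) (UScal b))
| ueq_scalM a b : ueq (UScal (a * b)) (UMul (UScal a) (UScal b))
| ueq_scalC a s : ueq (UMul (UScal a) s) (UMul s (UScal a))
| ueq_genD x y : ueq (UGen (x + y)) (UAdd (UGen x) (UGen y))
| ueq_genZ a x : ueq (UGen (a *: x)) (UMul (UScal a) (UGen x))
| ueq_lie x y :
    ueq (UAdd (UGen (lie x y)) (UMul (UGen y) (UGen x)))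
        (UMul (UGen x) (UGen y)).

HB.instance Definition _ := gen_eqMixin uterm.
HB.instance Definition _ := gen_choiceMixin uterm.

Definition ueqb (s t : uterm) : bool := `[< ueq s t >].

Lemma ueqb_refl : reflexive ueqb.
Proof. by move=> s; apply/asboolP; apply: ueq_refl. Qed.
Lemma ueqb_sym : symmetric ueqb.
Proof.
by move=> s t; apply/idP/idP => /asboolP h; apply/asboolP; apply: ueq_sym.
Qed.
Lemma ueqb_trans : transitive ueqb.
Proof.
move=> t s u /asboolP h1 /asboolP h2; apply/asboolP; exact: ueq_trans h1 h2.
Qed.

Canonical ueqb_equiv := EquivRel ueqb ueqb_refl ueqb_sym ueqb_trans.

Definition uenv := {eq_quot ueqb_equiv}.
HB.instance Definition _ := Choice.on uenv.
HB.instance Definition _ := EqQuotient.on uenv.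

Lemma upi_eq s t : ueq s t -> \pi_uenv s = \pi_uenv t.
Proof. by move=> h; apply/eqmodP; apply/asboolP. Qed.
Lemma ueq_pi s t : \pi_uenv s = \pi_uenv t -> ueq s t.
Proof. by move/eqmodP/asboolP. Qed.
Lemma ueq_repr s : ueq (repr (\pi_uenv s)) s.
Proof. by apply: ueq_pi; rewrite reprK. Qed.

Definition uscal (a : k) : uenv := \pi_uenv (UScal a).
Definition uadd : uenv -> uenv -> uenv :=
  locked (fun s t => \pi_uenv (UAdd (repr s) (repr t))).
Definition umul : uenv -> uenv -> uenv :=
  locked (fun s t => \pi_uenv (UMul (repr s) (repr t))).
Definition uopp (s : uenv) : uenv := umul (uscal (-1)) s.
Definition uscale (a : k) (s : uenv) : uenv := umul (uscal a) s.

Lemma uaddE s t : uadd (\pi_uenv s) (\pi_uenv t) = \pi_uenv (UAdd s t).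
Proof. by rewrite /uadd -lock; apply: upi_eq; apply: ueq_add; apply: ueq_repr. Qed.
Lemma umulE s t : umul (\pi_uenv s) (\pi_uenv t) = \pi_uenv (UMul s t).
Proof. by rewrite /umul -lock; apply: upi_eq; apply: ueq_mul; apply: ueq_repr. Qed.

Lemma uaddA : associative uadd.
Proof.
elim/quotW=> s; elim/quotW=> t; elim/quotW=> u.
by rewrite !uaddE; apply: upi_eq; apply: ueq_addA.
Qed.
Lemma uaddC : commutative uadd.
Proof.
elim/quotW=> s; elim/quotW=> t; rewrite !uaddE; apply: upi_eq; exact: ueq_addC.
Qed.
Lemma uadd0 : left_id (uscal 0) uadd.
Proof. elim/quotW=> s; rewrite uaddE; apply: upi_eq; exact: ueq_add0. Qed.
Lemma uaddN : left_inverse (uscal 0) uopp uadd.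
Proof.
elim/quotW=> s; rewrite /uopp umulE uaddE; apply: upi_eq; exact: ueq_addN.
Qed.

HB.instance Definition _ := GRing.isZmodule.Build uenv uaddA uaddC uadd0 uaddN.

Lemma umulA : associative umul.
Proof.
elim/quotW=> s; elim/quotW=> t; elim/quotW=> u.
by rewrite !umulE; apply: upi_eq; apply: ueq_mulA.
Qed.
Lemma umul1l : left_id (uscal 1) umul.
Proof. elim/quotW=> s; rewrite umulE; apply: upi_eq; exact: ueq_mul1l. Qed.
Lemma umul1r : right_id (uscal 1) umul.
Proof. elim/quotW=> s; rewrite umulE; apply: upi_eq; exact: ueq_mul1r. Qed.
Lemma umulDl : left_distributive umul uadd.
Proof.
elim/quotW=> s; elim/quotW=> t; elim/quotW=> u.
by rewrite !(umulE, uaddE); apply: upi_eq; apply: ueq_mulDl.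
Qed.
Lemma umulDr : right_distributive umul uadd.
Proof.
elim/quotW=> s; elim/quotW=> t; elim/quotW=> u.
by rewrite !(umulE, uaddE); apply: upi_eq; apply: ueq_mulDr.
Qed.

Section Eval.
Variables (A : pzRingType) (sc : k -> A) (f : g -> A).

Fixpoint ueval (t : uterm) : A :=
  match t with
  | UGen x => f x
  | UScal a => sc a
  | UAdd s t => ueval s + ueval t
  | UMul s t => ueval s * ueval t
  end.

Definition ulift (u : uenv) : A := ueval (repr u).

Hypotheses (scD : {morph sc : a b / a + b}) (scM : {morph sc : a b / a * b}).
Hypotheses (sc1 : sc 1 = 1) (scC : forall a x, sc a * x = x * sc a).
Hypotheses (fD : {morph f : x y / x + y}).
Hypotheses (fZ : forall a x, f (a *: x) = sc a * f x).
Hypotheses (fL : forall x y, f (lie x y) = f x * f y - f y * f x).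

Let sc0 : sc 0 = 0.
Proof. by apply: (@addrI _ (sc 0)); rewrite -scD !addr0. Qed.
Let scN1 : sc (-1) = -1.
Proof. by apply: (@addIr _ 1); rewrite -{1}sc1 -scD !addNr sc0. Qed.

Lemma ueval_eq s t : ueq s t -> ueval s = ueval t.
Proof.
elim=> //=.
- by move=> s0 t0 u _ -> _ ->.
- by move=> s0 s' t0 t' _ -> _ ->.
- by move=> s0 s' t0 t' _ -> _ ->.
- by move=> *; rewrite addrA.
- by move=> *; rewrite addrC.
- by move=> *; rewrite sc0 add0r.
- by move=> *; rewrite scN1 mulN1r addNr sc0.
- by move=> *; rewrite mulrA.
- by move=> *; rewrite sc1 mul1r.
- by move=> *; rewrite sc1 mulr1.
- by move=> *; rewrite mulrDl.
- by move=> *; rewrite mulrDr.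
- by move=> x y; rewrite fL subrK.
Qed.

Lemma ulift_pi t : ulift (\pi_uenv t) = ueval t.
Proof. exact/ueval_eq/ueq_repr. Qed.
Lemma ulift_uadd u v : ulift (uadd u v) = ulift u + ulift v.
Proof. by elim/quotW: u => s; elim/quotW: v => t; rewrite uaddE !ulift_pi. Qed.
Lemma ulift_umul u v : ulift (umul u v) = ulift u * ulift v.
Proof. by elim/quotW: u => s; elim/quotW: v => t; rewrite umulE !ulift_pi. Qed.
Lemma ulift_uscal a : ulift (uscal a) = sc a.
Proof. exact: ulift_pi. Qed.
End Eval.

Lemma uscal_neq : uscal 1 != 0.
Proof.
apply/eqP => /(congr1 (@ulift k id (fun=> 0))).
have L a : @ulift k id (fun=> 0) (uscal a) = a.
  apply: ulift_uscal => // *; first exact: mulrC.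
  - by move=> ? ?; rewrite addr0.
  - by rewrite /= mulr0.
  by rewrite /= mulr0 subr0.
have -> : (0 : uenv) = uscal 0 by [].
by rewrite !L => /eqP; rewrite oner_eq0.
Qed.

HB.instance Definition _ := GRing.Zmodule_isNzRing.Build uenv
  umulA umul1l umul1r umulDl umulDr uscal_neq.

Lemma uscalM a b : uscal (a * b) = uscal a * uscal b.
Proof. by rewrite -[RHS]/(umul _ _) umulE; apply: upi_eq; apply: ueq_scalM. Qed.
Lemma uscalD a b : uscal (a + b) = uscal a + uscal b.
Proof. by rewrite -[RHS]/(uadd _ _) uaddE; apply: upi_eq; apply: ueq_scalD. Qed.
Lemma uscalC a u : uscal a * u = u * uscal a.
Proof.
elim/quotW: u => s; rewrite -[LHS]/(umul _ _) -[RHS]/(umul _ _) !umulE.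
by apply: upi_eq; apply: ueq_scalC.
Qed.

Lemma uscaleA a b u : uscale a (uscale b u) = uscale (a * b) u.
Proof. by rewrite /uscale umulA -[umul (uscal a) _]uscalM. Qed.
Lemma uscale1 : left_id 1 uscale.
Proof. exact: umul1l. Qed.
Lemma uscaleDr : right_distributive uscale +%R.
Proof. by move=> a u v; apply: umulDr. Qed.
Lemma uscaleDl u : {morph uscale^~ u : a b / a + b}.
Proof. by move=> a b; rewrite /uscale uscalD; apply: umulDl. Qed.

HB.instance Definition _ := GRing.Zmodule_isLmodule.Build k uenv
  uscaleA uscale1 uscaleDr uscaleDl.

Lemma uscalerAl (a : k) (u v : uenv) : a *: (u * v) = (a *: u) * v.
Proof. exact: umulA. Qed.
HB.instance Definition _ := GRing.Lmodule_isLalgebra.Build k uenv uscalerAl.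
Lemma uscalerAr (a : k) (u v : uenv) : a *: (u * v) = u * (a *: v).
Proof.
by rewrite -[LHS]/(uscal a * (u * v)) -[a *: v]/(uscal a * v) mulrA uscalC mulrA.
Qed.
HB.instance Definition _ := GRing.Lalgebra_isAlgebra.Build k uenv uscalerAr.

Definition ugen (x : g) : uenv := \pi_uenv (UGen x).

Lemma ugen_linear : linear ugen.
Proof.
move=> a x y; rewrite -[RHS]/(uadd (umul _ _) _) umulE uaddE.
apply: upi_eq; apply: ueq_trans (ueq_genD _ _) _.
by apply: ueq_add; [apply: ueq_genZ|apply: ueq_refl].
Qed.
Lemma ugen_lie x y : ugen (lie x y) = ugen x * ugen y - ugen y * ugen x.
Proof.
apply: (@addIr _ (ugen y * ugen x)); rewrite subrK.
rewrite -[LHS]/(uadd _ (umul _ _)) -[RHS]/(umul _ _) !umulE uaddE.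
by apply: upi_eq; apply: ueq_lie.
Qed.
Lemma uscalE a : uscal a = a%:A.
Proof. by rewrite -[RHS]/(umul _ _) umul1r. Qed.

Lemma uenv_ind (P : uenv -> Prop) :
  (forall x, P (ugen x)) -> (forall a : k, P a%:A) ->
  (forall u v, P u -> P v -> P (u + v)) ->
  (forall u v, P u -> P v -> P (u * v)) -> forall u, P u.
Proof.
move=> Pg Ps Pa Pm; elim/quotW; elim=> [x|a|s IHs t IHt|s IHs t IHt].
- exact: Pg.
- by rewrite -[X in P X]/(uscal a) uscalE.
- by rewrite -uaddE; apply: Pa.
by rewrite -umulE; apply: Pm.
Qed.

End EnvelopingTerms.

Arguments uenv {k} g.

Section EnvelopingHopf.
Variables (k : fieldType) (g : lieAlgType k).
Notation U := (uenv g).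
Notation UU := (tensor U U).

(* Universal property of U(g), for targets that need not be nonzero rings. *)
Section Lift.
Variables (A : pzRingType) (sc : k -> A) (f : g -> A).
Hypotheses (scD : {morph sc : a b / a + b}) (scM : {morph sc : a b / a * b}).
Hypotheses (sc1 : sc 1 = 1) (scC : forall a x, sc a * x = x * sc a).
Hypotheses (fD : {morph f : x y / x + y}).
Hypotheses (fZ : forall a x, f (a *: x) = sc a * f x).
Hypotheses (fL : forall x y, f (lie x y) = f x * f y - f y * f x).

Lemma uliftD : {morph (ulift sc f : U -> A) : u v / u + v}.
Proof. by move=> u v; apply: ulift_uadd. Qed.
Lemma uliftM : {morph (ulift sc f : U -> A) : u v / u * v}.
Proof. by move=> u v; apply: ulift_umul. Qed.
Lemma ulift_scal a : ulift sc f (a%:A : U) = sc a.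
Proof. by rewrite -uscalE; apply: ulift_uscal. Qed.
Lemma ulift_gen x : ulift sc f (ugen x) = f x.
Proof. exact: ulift_pi. Qed.
Lemma uliftZ a (u : U) : ulift sc f (a *: u) = sc a * ulift sc f u.
Proof. by rewrite -[u in LHS]mul1r scalerAl uliftM ulift_scal. Qed.
Lemma ulift1 : ulift sc f (1 : U) = 1.
Proof. by rewrite -(scale1r (1 : U)) ulift_scal. Qed.
End Lift.

Definition ucounit : U -> k := ulift id (fun=> 0).

Lemma ucounit_hyps :
  [/\ {morph (fun=> 0 : k) : x y / (x : g) + y >-> x + y},
      forall (a : k) (x : g), 0 = a * 0 & forall x y : g, 0 = 0 * 0 - 0 * 0 :> k].
Proof. by split=> [? ?|? ?|? ?]; rewrite ?addr0 ?mulr0 ?subr0. Qed.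
Lemma kC (a x : k) : id a * x = x * id a. Proof. exact: mulrC. Qed.

Lemma ucounitD : {morph ucounit : u v / u + v}.
Proof. by case: ucounit_hyps => *; apply: uliftD => //; apply: kC. Qed.
Lemma ucounitM : {morph ucounit : u v / u * v}.
Proof. by case: ucounit_hyps => *; apply: uliftM => //; apply: kC. Qed.
Lemma ucounit_scal a : ucounit a%:A = a.
Proof. by case: ucounit_hyps => *; apply: ulift_scal => //; apply: kC. Qed.
Lemma ucounit_gen x : ucounit (ugen x) = 0.
Proof. by case: ucounit_hyps => *; apply: ulift_gen => //; apply: kC. Qed.
Lemma ucounit1 : ucounit 1 = 1.
Proof. by rewrite -(scale1r (1 : U)) ucounit_scal. Qed.
Lemma ucounit_linear : scalar ucounit.
Proof.
by move=> a u v; rewrite ucounitD -[u]mul1r scalerAl ucounitM ucounit_scal mul1r.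
Qed.

Definition ucomul : U -> UU :=
  ulift (fun a : k => a *: (1 : UU)) (fun x => ugen x \ox 1 + 1 \ox ugen x).

Lemma ugenD (x y : g) : ugen (x + y) = ugen x + ugen y.
Proof. exact: linD (@ugen_linear k g) x y. Qed.
Lemma ugenZ a (x : g) : ugen (a *: x) = a *: ugen x.
Proof. exact: linZ (@ugen_linear k g) a x. Qed.

Definition tsc (a : k) : UU := a *: (1 : UU).
Lemma tscD : {morph tsc : a b / a + b}.
Proof. by move=> a b; rewrite /tsc scalerDl. Qed.
Lemma tscM : {morph tsc : a b / a * b}.
Proof. by move=> a b; rewrite /tsc -tensor_scalerAl mul1r scalerA. Qed.
Lemma tsc1 : tsc 1 = 1.
Proof. exact: scale1r. Qed.
Lemma tscC a t : tsc a * t = t * tsc a.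
Proof. by rewrite /tsc -tensor_scalerAl -tensor_scalerAr mul1r mulr1. Qed.

Definition tgen (x : g) : UU := ugen x \ox 1 + 1 \ox ugen x.
Lemma tgenD : {morph tgen : x y / x + y}.
Proof. by move=> x y; rewrite /tgen ugenD tpureDl tpureDr addrACA. Qed.
Lemma tgenZ a x : tgen (a *: x) = tsc a * tgen x.
Proof.
by rewrite /tgen ugenZ tpureZl tpureZr -scalerDr /tsc -tensor_scalerAl mul1r.
Qed.
Lemma tgen_lie x y : tgen (lie x y) = tgen x * tgen y - tgen y * tgen x.
Proof.
rewrite /tgen ugen_lie !(mulrDl, mulrDr) !tpureM !(mul1r, mulr1) tpureBl tpureBr.
move: (ugen x) (ugen y) => {}x {}y.
set a := (x * y) \ox 1; set b := x \ox y; set c := y \ox x.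
set d := 1 \ox (x * y); set e := (y * x) \ox 1; set f := 1 \ox (y * x).
have -> : a + b + (c + d) = (a + d) + (b + c) by rewrite [c + d]addrC addrACA.
symmetry. have -> : e + c + (b + f) = (e + f) + (b + c).
  by rewrite [b + f]addrC addrACA [c + b]addrC.
by rewrite opprD addrACA subrr addr0 opprD addrACA.
Qed.

Lemma ucomulD : {morph ucomul : u v / u + v}.
Proof. exact: uliftD tscD tscM tsc1 tscC tgenD tgenZ tgen_lie. Qed.
Lemma ucomulM : {morph ucomul : u v / u * v}.
Proof. exact: uliftM tscD tscM tsc1 tscC tgenD tgenZ tgen_lie. Qed.
Lemma ucomul_scal a : ucomul a%:A = a *: (1 : UU).
Proof. exact: ulift_scal tscD tscM tsc1 tscC tgenD tgenZ tgen_lie a. Qed.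
Lemma ucomul_gen x : ucomul (ugen x) = ugen x \ox 1 + 1 \ox ugen x.
Proof. exact: ulift_gen tscD tscM tsc1 tscC tgenD tgenZ tgen_lie x. Qed.
Lemma ucomul1 : ucomul 1 = 1.
Proof. by rewrite -(scale1r (1 : U)) ucomul_scal scale1r. Qed.
Lemma ucomul_linear : linear ucomul.
Proof.
move=> a u v; rewrite ucomulD -[u in LHS]mul1r scalerAl ucomulM ucomul_scal.
by rewrite -tensor_scalerAl mul1r.
Qed.

Let mulU := @mulr_bilinear k U.
Let mulUU := tmul_bilinear mulU mulU.

Lemma linear_idU : linear (id : U -> U). Proof. by []. Qed.

Lemma ucomulA u :
  tassoc (tmap ucomul id (ucomul u)) = tmap id ucomul (ucomul u).
Proof.
have TL := linD (tmap_linear ucomul_linear linear_idU).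
have TR := linD (tmap_linear linear_idU ucomul_linear).
have TA := linD (@tassoc_linear k U U U).
have ZL := linZ (tmap_linear ucomul_linear linear_idU).
have ZR := linZ (tmap_linear linear_idU ucomul_linear).
have ZA := linZ (@tassoc_linear k U U U).
have PL x y : tmap ucomul id (x \ox y) = ucomul x \ox y.
  by rewrite tmap_pure //; apply: ucomul_linear.
have PR x y : tmap id ucomul (x \ox y) = x \ox ucomul y.
  by rewrite tmap_pure //; apply: ucomul_linear.
elim/uenv_ind: u => [x|a|u v IHu IHv|u v IHu IHv].
- rewrite ucomul_gen TL TR !PL !PR ucomul_gen ucomul1 !tensor_oneE.
  by rewrite tpureDl tpureDr !TA !tassoc_pure addrA.
- rewrite ucomul_scal tensor_oneE ZL ZR ZA PL PR ucomul1 tensor_oneE.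
  by rewrite tassoc_pure.
- by rewrite ucomulD TL TR TA IHu IHv.
rewrite ucomulM tensor_mulE.
rewrite (tmap_tmul _ _ mulU mulU mulUU mulU ucomul_linear linear_idU ucomulM) //.
rewrite (tmap_tmul _ _ mulU mulU mulU mulUU linear_idU ucomul_linear _ ucomulM) //.
by rewrite tassoc_tmul // IHu IHv.
Qed.

Lemma ucounitl_bilin :
  bilinear_for *:%R *:%R (fun a b : U => ucounit a *: b).
Proof.
apply: bilinI => [w a x y|w a x y].
  by rewrite ucounit_linear scalerDl scalerA.
by rewrite scalerDr !scalerA mulrC.
Qed.
Lemma ucounitr_bilin :
  bilinear_for *:%R *:%R (fun a b : U => ucounit b *: a).
Proof.
apply: bilinI => [w a x y|w a x y].
  by rewrite scalerDr !scalerA mulrC.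
by rewrite ucounit_linear scalerDl scalerA.
Qed.

(* A linear map on U ⊗ U that is multiplicative on pure tensors is
   multiplicative. *)
Lemma tlift_mul (A : algType k) (f : U -> U -> A) (s t : UU) :
  bilinear_for *:%R *:%R f ->
  (forall a b c d, f (a * c) (b * d) = f a b * f c d) ->
  tlift f (s * t) = tlift f s * tlift f t.
Proof.
move=> hf fM.
elim/tensor_ind: s => [a b|s s' IH IH']; last by rewrite mulrDl !tliftD // mulrDl IH IH'.
elim/tensor_ind: t => [c d|t t' IH IH']; last by rewrite mulrDr !tliftD // mulrDr IH IH'.
by rewrite tpureM !tlift_pure.
Qed.

Lemma ucounitl u : tlift (fun a b => ucounit a *: b) (ucomul u) = u.
Proof.
have hf := ucounitl_bilin.
elim/uenv_ind: u => [x|a|u v IHu IHv|u v IHu IHv].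
- rewrite ucomul_gen tliftD // !tlift_pure // ucounit_gen ucounit1.
  by rewrite scale0r add0r scale1r.
- by rewrite ucomul_scal tliftZ // tlift_pure // ucounit1 scale1r.
- by rewrite ucomulD tliftD // IHu IHv.
rewrite ucomulM tlift_mul ?IHu ?IHv // => a b c d.
by rewrite ucounitM -scalerAl -scalerAr scalerA.
Qed.

Lemma ucounitr u : tlift (fun a b => ucounit b *: a) (ucomul u) = u.
Proof.
have hf := ucounitr_bilin.
elim/uenv_ind: u => [x|a|u v IHu IHv|u v IHu IHv].
- rewrite ucomul_gen tliftD // !tlift_pure // ucounit_gen ucounit1.
  by rewrite scale0r addr0 scale1r.
- by rewrite ucomul_scal tliftZ // tlift_pure // ucounit1 scale1r.
- by rewrite ucomulD tliftD // IHu IHv.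
rewrite ucomulM tlift_mul ?IHu ?IHv // => a b c d.
by rewrite ucounitM -scalerAl -scalerAr scalerA.
Qed.

HB.instance Definition _ := Lmodule_isCoalgebra.Build k U
  ucomul_linear ucounit_linear ucomulA ucounitl ucounitr.
HB.instance Definition _ := Algebra_isBialgebra.Build k U
  ucomul1 ucomulM ucounit1 ucounitM.

(* The antipode is the antiautomorphism with x ↦ -x on g, i.e. a ring
   homomorphism into the converse ring U^c. *)
Definition uantipode : U -> U :=
  @ulift k g U^c (fun a => a%:A) (fun x => - ugen x).

Lemma cscD : {morph (fun a : k => a%:A : U^c) : a b / a + b}.
Proof. by move=> a b; apply: scalerDl. Qed.
Lemma cscM : {morph (fun a : k => a%:A : U^c) : a b / a * b}.
Proof.
move=> a b; rewrite mulrC -[RHS]/((b%:A : U) * a%:A) -scalerAl mul1r.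
by rewrite scalerA.
Qed.
Lemma csc1 : (1%:A : U^c) = 1. Proof. exact: scale1r. Qed.
Lemma cscC (a : k) (x : U^c) : (a%:A : U^c) * x = x * (a%:A : U^c).
Proof.
rewrite -[LHS]/((x : U) * a%:A) -[RHS]/((a%:A : U) * x).
by rewrite -scalerAl -scalerAr mul1r mulr1.
Qed.
Lemma cgenD : {morph (fun x => - ugen x : U^c) : x y / (x : g) + y >-> x + y}.
Proof. by move=> x y; rewrite ugenD; apply: opprD. Qed.
Lemma cgenZ (a : k) (x : g) : (- ugen (a *: x) : U^c) = (a%:A : U^c) * (- ugen x).
Proof.
rewrite -[RHS]/((- ugen x : U) * a%:A) ugenZ -scalerAr mulr1 scalerN.
by [].
Qed.
Lemma cgen_lie (x y : g) : (- ugen (lie x y) : U^c) =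
  (- ugen x : U^c) * (- ugen y) - (- ugen y : U^c) * (- ugen x).
Proof.
rewrite -[RHS]/((- ugen y : U) * (- ugen x) - (- ugen x : U) * (- ugen y)).
by rewrite !mulrNN ugen_lie opprB.
Qed.

Lemma uantipodeD : {morph uantipode : u v / u + v}.
Proof. exact: uliftD cscD cscM csc1 cscC cgenD cgenZ cgen_lie. Qed.
Lemma uantipodeM u v : uantipode (u * v) = uantipode v * uantipode u.
Proof. exact: (uliftM cscD cscM csc1 cscC cgenD cgenZ cgen_lie). Qed.
Lemma uantipode_scal (a : k) : uantipode a%:A = a%:A.
Proof. exact: (ulift_scal cscD cscM csc1 cscC cgenD cgenZ cgen_lie). Qed.
Lemma uantipode_gen x : uantipode (ugen x) = - ugen x.
Proof. exact: (ulift_gen cscD cscM csc1 cscC cgenD cgenZ cgen_lie). Qed.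
Lemma uantipode1 : uantipode 1 = 1.
Proof. by rewrite -(scale1r (1 : U)) uantipode_scal. Qed.
Lemma uantipode_linear : linear uantipode.
Proof.
move=> a u v; rewrite uantipodeD -[u in LHS]mulr1 scalerAr uantipodeM.
by rewrite uantipode_scal -scalerAl mul1r.
Qed.

Lemma uantipodel_bilin :
  bilinear_for *:%R *:%R (fun a b => uantipode a * b).
Proof.
apply: bilinI => [w a x y|w a x y].
  by rewrite uantipode_linear mulrDl scalerAl.
by rewrite mulrDr scalerAr.
Qed.
Lemma uantipoder_bilin :
  bilinear_for *:%R *:%R (fun a b => a * uantipode b).
Proof.
apply: bilinI => [w a x y|w a x y].
  by rewrite mulrDl scalerAl.
by rewrite uantipode_linear mulrDr scalerAr.
Qed.

(* If S(s_1) s_2 is the scalar c, then S(s_1 t_1) s_2 t_2 = c S(t_1) t_2. *)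
Lemma uantipodel_mul (s t : UU) (c : k) :
  tlift (fun a b => uantipode a * b) s = c%:A ->
  tlift (fun a b => uantipode a * b) (s * t) =
    c *: tlift (fun a b => uantipode a * b) t.
Proof.
have hf := uantipodel_bilin => hs.
elim/tensor_ind: t => [x y|t t' IH IH']; last first.
  by rewrite mulrDr !tliftD // scalerDr IH IH'.
rewrite tlift_pure // -[c *: _]mul1r.
suff -> : tlift (fun a b => uantipode a * b) (s * (x \ox y)) =
    uantipode x * tlift (fun a b => uantipode a * b) s * y.
  by rewrite hs -scalerAr mulr1 mul1r -scalerAl.
elim/tensor_ind: s {hs} => [a b|s s' IH IH'].
  by rewrite tpureM !tlift_pure // uantipodeM !mulrA.
by rewrite mulrDl !tliftD // mulrDr mulrDl IH IH'.
Qed.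
Lemma uantipoder_mul (s t : UU) (c : k) :
  tlift (fun a b => a * uantipode b) t = c%:A ->
  tlift (fun a b => a * uantipode b) (s * t) =
    c *: tlift (fun a b => a * uantipode b) s.
Proof.
have hf := uantipoder_bilin => ht.
elim/tensor_ind: s => [x y|s s' IH IH']; last first.
  by rewrite mulrDl !tliftD // scalerDr IH IH'.
rewrite tlift_pure //.
suff -> : tlift (fun a b => a * uantipode b) ((x \ox y) * t) =
    x * tlift (fun a b => a * uantipode b) t * uantipode y.
  by rewrite ht -scalerAr mulr1 -scalerAl.
elim/tensor_ind: t {ht} => [a b|t t' IH IH'].
  by rewrite tpureM !tlift_pure // uantipodeM !mulrA.
by rewrite mulrDr !tliftD // mulrDr mulrDl IH IH'.
Qed.

Lemma uantipodel u :
  tlift (fun a b => uantipode a * b) (ucomul u) = (ucounit u)%:A.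
Proof.
have hf := uantipodel_bilin.
elim/uenv_ind: u => [x|a|u v IHu IHv|u v IHu IHv].
- rewrite ucomul_gen tliftD // !tlift_pure // uantipode_gen uantipode1.
  by rewrite ucounit_gen mulr1 mul1r addNr scale0r.
- by rewrite ucomul_scal tliftZ // tlift_pure // uantipode1 mulr1 ucounit_scal.
- by rewrite ucomulD tliftD // IHu IHv ucounitD scalerDl.
by rewrite ucomulM (uantipodel_mul _ IHu) IHv ucounitM scalerA.
Qed.
Lemma uantipoder u :
  tlift (fun a b => a * uantipode b) (ucomul u) = (ucounit u)%:A.
Proof.
have hf := uantipoder_bilin.
elim/uenv_ind: u => [x|a|u v IHu IHv|u v IHu IHv].
- rewrite ucomul_gen tliftD // !tlift_pure // uantipode_gen uantipode1.
  by rewrite ucounit_gen mulr1 mul1r addrN scale0r.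
- by rewrite ucomul_scal tliftZ // tlift_pure // uantipode1 mulr1 ucounit_scal.
- by rewrite ucomulD tliftD // IHu IHv ucounitD scalerDl.
by rewrite ucomulM (uantipoder_mul _ IHv) IHu ucounitM scalerA mulrC.
Qed.

HB.instance Definition _ := Bialgebra_isHopf.Build k U
  uantipode_linear uantipodel uantipoder.

End EnvelopingHopf.

Section Restriction.
Variables (k : fieldType) (H : hopfAlgType k).

Lemma difference_operator1 (D : H -> H) : difference_operator D -> D 1 = 1.
Proof.
case=> -[Dlin Dcomul Dcounit] DM.
have DL : linear (fun a : H => D a) by exact: Dlin.
have bS : bilinear_for *:%R *:%R (fun a b : H => antipode a * b).
  apply: bilinI => [w a x y|w a x y]; first by rewrite antipode_linear mulrDl scalerAl.
  by rewrite mulrDr scalerAr.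
have e1 : comul (D 1) = D 1 \ox D 1.
  by rewrite Dcomul comul1 tensor_oneE tmap_pure.
have inv : antipode (D 1) * D 1 = 1.
  have := antipodel (D 1); rewrite e1 tlift_pure // Dcounit counit1 => ->.
  by rewrite scale1r.
have S1 : antipode (1 : H) = 1.
  have := antipodel (1 : H); rewrite comul1 tensor_oneE tlift_pure // counit1.
  by rewrite mulr1 scale1r.
have idem : D 1 = D 1 * D 1.
  have := DM 1 1; rewrite mulr1 comul1 tensor_oneE tmap_pure //; last first.
    exact: comul_linear.
  rewrite comul1 tensor_oneE => e2; rewrite {1}e2.
  have b1 (z : H) : bilinear_for *:%R *:%R
      (fun x1 x2 : H => D x1 * x2 * D 1 * antipode z).
    apply: bilinI => [w a x y|w a x y].
      by rewrite Dlin !mulrDl !scalerAl.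
    by rewrite mulrDr !mulrDl -!scalerAr -!scalerAl.
  have b2 : bilinear_for *:%R *:%R (fun (x12 : tensor H H) (x3 : H) =>
      tlift (fun x1 x2 => D x1 * x2 * D 1 * antipode x3) x12).
    apply: bilinI => [w|w a x y]; first exact/tlift_linear/b1.
    by apply: tlift_comb => u v; rewrite antipode_linear mulrDr scalerAr.
  by rewrite (tlift_pure b2) (tlift_pure (b1 1)) S1 !mulr1.
by have := inv; rewrite {2}idem mulrA inv mul1r.
Qed.

Lemma difference_operator_primitive (D : H -> H) (c : H) :
  difference_operator D -> c \in primitive -> D c \in primitive.
Proof.
move=> hD /primitiveP hc; apply/primitiveP; have D1 := difference_operator1 hD.
case: hD => -[Dlin Dcomul _] _.
by rewrite Dcomul hc (linD (tmap_linear Dlin Dlin)) !tmap_pure // D1.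
Qed.

Definition prim_restr (D : H -> H) (hD : difference_operator D) (c : prim H) :
    prim H :=
  Prim (difference_operator_primitive hD (valP c)).

End Restriction.

(* Main.v *)
Require Import Defs.
From HB Require Import structures.
From mathcomp Require Import all_boot all_order all_algebra sesquilinear.
From mathcomp.classical Require Import boolp classical_sets.

Set Implicit Arguments.
Unset Strict Implicit.
Unset Printing Implicit Defensive.

Import GRing.Theory.
Local Open Scope ring_scope.
Local Open Scope hopf_scope.

(** This is the theorem of Cartier, Milnor and Moore for connected
    cocommutative Hopf algebras in characteristic 0, together with the remark
    that a difference operator is determined by its values on primitive
    elements.  The isomorphism is the algebra map phi : U(P(H)) -> H extending
    the inclusion of P(H).

    It intertwines the operators because, for primitive c, the defining
    identity reads D(cy) = D(c)D(y) + cD(y) - D(y)c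
    ([difference_operator_primitiveM]).  Both operators obey this rule and
    agree on P(H), so induction on products of generators concludes.

    Bijectivity rests on the convolution rings Hom(H, A).  First, H is
    conilpotent: if J : H -> A is linear and kills 1, each x in H is killed by
    high convolution powers of J ([connected_conilpotent]).  The proof lets
    functionals f act on H by f.x = x_1 f(x_2) and measures x by the least
    number of pure tensors in Delta(x) modulo 1 (x) H.  If f(1) = 0, this
    number drops from x to f.x as long as f.x <> 0; otherwise x would be
    recovered from f.x, which is impossible because connectedness puts 1 in
    the orbit of every nonzero element.

    By conilpotency, the convolution power Psi^n = id^n is polynomial in n:
    Psi^n(x) = sum_j n^j e_j(x).  Comparing coefficients, which is legitimate
    in characteristic 0, turns identities between the Psi^n into identities
    between the e_j.  From Delta Psi^n = (Psi^n (x) Psi^n) Delta one gets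
    that e = e_1, the logarithm of id, takes primitive values
    ([eulerian_primitive]); from Psi^(n+m) = Psi^n * Psi^m one gets
    e * e_j = (j+1) e_(j+1), whence id = exp(e) ([conv_exp_eulerian]); and
    Psi^m(c^n) = m^n c^n for primitive c gives e(c^n) = 0 unless n = 1
    ([eulerian_primitiveX]).

    Let psi : H -> U(P(H)) be the convolution exponential of e, regarded as a
    map into U(P(H)).  Then phi psi = exp(e) = id.  Also
    psi(c^n) = c^n in U(P(H)) for primitive c, and U(P(H)) is spanned by such
    powers ([uenv_span_powers]), so psi phi = id. *)

(** * Linear algebra over a field *)

Section LinearMaps.
Variable k : fieldType.

Lemma id_linear (V : lmodType k) : linear (id : V -> V). Proof. by []. Qed.

Lemma linear_comp (V W X : lmodType k) (p : V -> W) (q : W -> X) :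
  linear p -> linear q -> linear (fun x => q (p x)).
Proof. by move=> hp hq a x y /=; rewrite hp hq. Qed.

Lemma lin_sum (V W : lmodType k) (f : V -> W) (I : Type) (r : seq I)
    (P : pred I) (F : I -> V) :
  linear f -> f (\sum_(i <- r | P i) F i) = \sum_(i <- r | P i) f (F i).
Proof. by move=> hf; apply: big_morph; [apply: linD|apply: lin0]. Qed.

Lemma scalar0 (V : lmodType k) (f : V -> k) : scalar f -> f 0 = 0.
Proof. by move=> hf; apply: (@lin0 k V k^o f). Qed.

Lemma scalarZ (V : lmodType k) (f : V -> k) :
  scalar f -> forall a x, f (a *: x) = a * f x.
Proof. by move=> hf; apply: (@linZ k V k^o f). Qed.

Lemma scalar_sum (V : lmodType k) (f : V -> k) n (a : 'I_n -> V) :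
  scalar f -> f (\sum_i a i) = \sum_i f (a i).
Proof. by move=> hf; apply: (@lin_sum V k^o f). Qed.

Lemma scale_bilinear_left (V W : lmodType k) (f : V -> k) :
  scalar f -> bilinear_for *:%R *:%R (fun (a : V) (b : W) => f a *: b).
Proof.
move=> hf; apply: bilinI => [w a u v|w a u v] /=.
  by rewrite hf scalerDl scalerA.
by rewrite scalerDr !scalerA mulrC.
Qed.

Lemma scale_bilinear_right (V W : lmodType k) (f : W -> k) :
  scalar f -> bilinear_for *:%R *:%R (fun (a : V) (b : W) => f b *: a).
Proof.
move=> hf; apply: bilinI => [w a u v|w a u v] /=.
  by rewrite scalerDr !scalerA mulrC.
by rewrite hf scalerDl scalerA.
Qed.

Lemma mul_bilinear (V W : lmodType k) (A : algType k) (f : V -> A) (g : W -> A) :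
  linear f -> linear g -> bilinear_for *:%R *:%R (fun a b => f a * g b).
Proof.
move=> hf hg; apply: bilinI => [w a x y|w a x y].
  by rewrite hf mulrDl scalerAl.
by rewrite hg mulrDr scalerAr.
Qed.

Lemma tpure_linear_right (V W : lmodType k) (v : V) :
  linear (fun w : W => v \ox w).
Proof. by move=> a x y; rewrite tpureDr tpureZr. Qed.

Lemma tpure_linear_left (V W : lmodType k) (w : W) :
  linear (fun v : V => v \ox w).
Proof. by move=> a x y; rewrite tpureDl tpureZl. Qed.

Lemma tlift_sum (V W X : lmodType k) (f : V -> W -> X) n
    (a : 'I_n -> V) (b : 'I_n -> W) :
  bilinear_for *:%R *:%R f ->
  tlift f (\sum_i a i \ox b i) = \sum_i f (a i) (b i).
Proof.
move=> hf; rewrite (lin_sum _ _ _ (tlift_linear hf)).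
by apply: eq_bigr => i _; rewrite tlift_pure.
Qed.

End LinearMaps.

Section Subspaces.
Variables (k : fieldType) (V : lmodType k).

Definition lin_closed (E : V -> Prop) :=
  E 0 /\ forall (a : k) x y, E x -> E y -> E (a *: x + y).

Section Closed.
Variables (E : V -> Prop) (hE : lin_closed E).

Lemma lin_closedD x y : E x -> E y -> E (x + y).
Proof. by move=> hx hy; rewrite -[x]scale1r; apply: hE.2. Qed.

Lemma lin_closedZ a x : E x -> E (a *: x).
Proof. by move=> hx; rewrite -[_ *: _]addr0; apply: hE.2 => //; apply: hE.1. Qed.

Lemma lin_closedB x y : E x -> E y -> E (x - y).
Proof. by move=> hx hy; rewrite -scaleN1r addrC; apply: hE.2. Qed.

Lemma lin_closed_sum (I : Type) (r : seq I) (P : pred I) (F : I -> V) :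
  (forall i, P i -> E (F i)) -> E (\sum_(i <- r | P i) F i).
Proof. by apply: big_ind; [apply: hE.1|apply: lin_closedD]. Qed.

End Closed.

(** The impredicative form makes [span_min], the only way in which membership
    in a span is exploited, immediate. *)
Definition span (G : V -> Prop) (v : V) :=
  forall E, lin_closed E -> (forall x, G x -> E x) -> E v.

Lemma span_closed G : lin_closed (span G).
Proof.
split=> [E hE _|a x y hx hy E hE GE]; first exact: hE.1.
by apply: hE.2; [apply: hx|apply: hy].
Qed.

Lemma span_gen (G : V -> Prop) x : G x -> span G x.
Proof. by move=> Gx E _; apply. Qed.

Lemma span_min (G E : V -> Prop) :
  lin_closed E -> (forall x, G x -> E x) -> forall v, span G v -> E v.
Proof. by move=> hE GE v; apply. Qed.

Lemma span_img n (a : 'I_n -> V) v :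
  span (fun x => exists i, x = a i) v ->
  exists c : 'I_n -> k, v = \sum_i c i *: a i.
Proof.
apply: (@span_min _ (fun v => exists c : 'I_n -> k, v = \sum_i c i *: a i)).
  split.
    by exists (fun=> 0); rewrite big1 // => i _; rewrite scale0r.
  move=> l _ _ [c ->] [d ->]; exists (fun i => l * c i + d i).
  rewrite scaler_sumr -big_split; apply: eq_bigr => i _ /=.
  by rewrite scalerDl scalerA.
move=> _ [i ->]; exists (fun j => (j == i)%:R).
rewrite (bigD1 i) //= eqxx scale1r big1 ?addr0 // => j /negbTE ->.
by rewrite scale0r.
Qed.

Local Open Scope classical_set_scope.

(** A maximal subspace that contains E and avoids v (Zorn) is a hyperplane
    complementary to the line through v; the functional is the coordinate
    along that line. *)
Lemma separating_functional (E : V -> Prop) (v : V) :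
  lin_closed E -> ~ E v ->
  exists f : V -> k, [/\ scalar f, forall x, E x -> f x = 0 & f v = 1].
Proof.
move=> hE Ev.
(* Working with E `|` A rather than A lets the empty chain have the union
   set0. *)
pose P : set (set V) := fun A => lin_closed (E `|` A) /\ ~ (E `|` A) v.
have [F FP Ftot|A [[hM Mv] Amax]] := @Zorn_bigcup V P.
  split; last by case=> // -[X FX Xv]; apply: (FP X FX).2; right.
  split=> [|a x y]; first by left; apply: hE.1.
  have up X z : F X -> (E `|` X) z -> (E `|` \bigcup_(Y in F) Y) z.
    by move=> FX [Ez|Xz]; [left|right; exists X].
  case=> [Ex|[X FX Xx]] [Ey|[Y FY Yy]]; first by left; apply: hE.2.
  - by apply: (up Y) => //; apply: (FP Y FY).1.2; [left|right].
  - by apply: (up X) => //; apply: (FP X FX).1.2; [right|left].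
  case: (Ftot X Y FX FY) => XY.
    by apply: (up Y) => //; apply: (FP Y FY).1.2; right=> //; apply: XY.
  by apply: (up X) => //; apply: (FP X FX).1.2; right=> //; apply: XY.
set M : V -> Prop := E `|` A in hM Mv.
have exc w : exists c, M (w - c *: v).
  have [Mw|Mw] := pselect (M w); first by exists 0; rewrite scale0r subr0.
  pose B : set V := fun z => exists m c, M m /\ z = m + c *: w.
  have MB z : M z -> B z by move=> Mz; exists z, 0; rewrite scale0r addr0.
  have EB z : (E `|` B) z -> B z by case=> // Ez; apply: MB; left.
  have AB : A `<` B.
    split=> [z Az|BA]; first by apply: MB; right.
    apply: Mw; right; apply: BA; exists 0, 1; rewrite add0r scale1r.
    by split=> //; apply: hM.1.
  have [m [c [Mm vE]]] : B v.
    apply: contrapT => Bv; apply: (Amax B AB); split=> [|/EB//].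
    split=> [|a x y /EB[m [c [Mm ->]]] /EB[n [d [Mn ->]]]].
      by left; apply: hE.1.
    right; exists (a *: m + n), (a * c + d); split; first exact: hM.2.
    by rewrite scalerDr scalerDl scalerA addrACA.
  have c0 : c != 0.
    by apply/eqP=> c0; apply: Mv; rewrite vE c0 scale0r addr0.
  exists c^-1; rewrite vE scalerDr scalerA mulVf // scale1r opprD addrCA subrr.
  by rewrite addr0 -scaleNr; apply: lin_closedZ.
have uniq w c d : M (w - c *: v) -> M (w - d *: v) -> c = d.
  move=> hc hd; apply/eqP; rewrite -subr_eq0; apply: contraPT Mv => cd; apply.
  rewrite -[v]scale1r -(mulVf cd) -scalerA; apply: lin_closedZ => //.
  have -> : (c - d) *: v = (w - d *: v) - (w - c *: v).
    by rewrite scalerBl opprB [RHS]addrC addrA subrK.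
  exact: lin_closedB.
pose f w := sval (cid (exc w)); have fP w : M (w - f w *: v).
  by rewrite /f; case: cid.
exists f; split=> [a x y|x Ex|].
- apply: (uniq (a *: x + y)) => //; have := hM.2 a _ _ (fP x) (fP y).
  by rewrite scalerBr scalerDl opprD addrACA -scalerA.
- by apply: (uniq x) => //; rewrite scale0r subr0; left.
by apply: (uniq v) => //; rewrite scale1r subrr; apply: hM.1.
Qed.

End Subspaces.

(** * Polynomial functions with vector coefficients *)

Section Expansions.
Variable k : fieldType.

(** F is the polynomial function n |-> sum_i n^i c_i with coefficients in V.
    The coefficients form an infinite sequence that vanishes from some index
    on, so that expansions can be added and multiplied without tracking
    degrees. *)
Definition expansion (V : lmodType k) (F c : nat -> V) :=
  exists N, (forall i, (N <= i)%N -> c i = 0) /\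
    forall n, F n = \sum_(i < N) n%:R ^+ i *: c i.

Section OneSpace.
Variable V : lmodType k.
Implicit Types F G c d : nat -> V.

Lemma sum_widen (a : nat -> k) c N M :
  (forall i, (N <= i)%N -> c i = 0) -> (N <= M)%N ->
  \sum_(i < N) a i *: c i = \sum_(i < M) a i *: c i.
Proof.
move=> c0 NM; rewrite (big_ord_widen M (fun i => a i *: c i) NM) big_mkcond.
apply: eq_bigr => i _; case: ltnP => // /c0 ->; by rewrite scaler0.
Qed.

Lemma eq_expansion F G c d : F =1 G -> c =1 d -> expansion F c -> expansion G d.
Proof.
move=> FG cd [N [c0 Fc]]; exists N; split=> [i /c0|n]; first by rewrite cd.
by rewrite -FG Fc; apply: eq_bigr => i _; rewrite cd.
Qed.

Lemma expansion_lin a F G c d :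
  expansion F c -> expansion G d ->
  expansion (fun n => a *: F n + G n) (fun i => a *: c i + d i).
Proof.
case=> N [c0 Fc] [M [d0 Gd]]; exists (maxn N M); split=> [i|n].
  by rewrite geq_max => /andP[/c0 -> /d0 ->]; rewrite scaler0 addr0.
rewrite Fc Gd (sum_widen _ c0 (leq_maxl N M)) (sum_widen _ d0 (leq_maxr N M)).
rewrite scaler_sumr -big_split; apply: eq_bigr => i _ /=.
by rewrite scalerDr !scalerA mulrC.
Qed.

Lemma expansion0 : expansion (fun=> 0 : V) (fun=> 0).
Proof. by exists 0; split=> // n; rewrite big_ord0. Qed.

Lemma expansionD F G c d : expansion F c -> expansion G d ->
  expansion (fun n => F n + G n) (fun i => c i + d i).
Proof.
by move=> h /(expansion_lin 1 h); apply: eq_expansion => n; rewrite scale1r.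
Qed.

Lemma expansionZ a F c : expansion F c ->
  expansion (fun n => a *: F n) (fun i => a *: c i).
Proof.
by move=> /expansion_lin-/(_ a _ _ expansion0); apply: eq_expansion => n;
  rewrite addr0.
Qed.

Lemma expansion_sum (I : Type) (r : seq I) (F c : I -> nat -> V) :
  (forall i, expansion (F i) (c i)) ->
  expansion (fun n => \sum_(i <- r) F i n) (fun j => \sum_(i <- r) c i j).
Proof.
move=> h; elim: r => [|i r IH].
  by apply: eq_expansion expansion0 => n; rewrite big_nil.
by apply: eq_expansion (expansionD (h i) IH) => n; rewrite big_cons.
Qed.

Lemma expansion_cst (v : V) :
  expansion (fun=> v) (fun i => (i == 0)%:R *: v).
Proof.
exists 1; split=> [[|i] // _|n]; first by rewrite scale0r.
by rewrite big_ord1 expr0 !scale1r.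
Qed.

Lemma expansion_shift F c : expansion F c ->
  expansion (fun n => n%:R *: F n) (fun i => if i is j.+1 then c j else 0).
Proof.
case=> N [c0 Fc]; exists N.+1; split=> [[|i] //|n]; first exact: c0.
rewrite big_ord_recl scaler0 add0r Fc scaler_sumr; apply: eq_bigr => i _ /=.
by rewrite scalerA -exprS.
Qed.

Lemma expansion_power (v : V) n :
  expansion (fun m => m%:R ^+ n *: v) (fun i => (i == n)%:R *: v).
Proof.
exists n.+1; split=> [i ni|m]; first by rewrite gtn_eqF // scale0r.
rewrite big_ord_recr /= eqxx scale1r big1 ?add0r // => i _.
by rewrite ltn_eqF // scale0r scaler0.
Qed.

Lemma expansion_at0 F c : expansion F c -> F 0 = c 0.
Proof.
case=> N [c0 ->]; case: N c0 => [|N] c0; first by rewrite big_ord0 c0.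
rewrite big_ord_recl expr0 scale1r big1 ?addr0 // => i _.
by rewrite expr0n /= scale0r.
Qed.

Hypothesis char0 : [pchar k] =i pred0.

Lemma natr_inj : injective (fun n : nat => n%:R : k).
Proof.
have /pcharf0P c0 := char0.
have le m n : (m <= n)%N -> m%:R = n%:R :> k -> m = n.
  move=> mn e; apply/eqP; rewrite eqn_leq mn /= -subn_eq0 -c0.
  by rewrite natrB // e subrr.
by move=> m n /= e; case/orP: (leq_total m n) => /le h; [|symmetry]; apply: h.
Qed.

(** Otherwise a functional vanishing on E but not at c_i would turn F into a
    nonzero polynomial over k with infinitely many roots 0, 1, 2, ...; these
    are distinct in characteristic 0. *)
Lemma expansion_mem (E : V -> Prop) F c :
  lin_closed E -> expansion F c -> (forall n, E (F n)) -> forall i, E (c i).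
Proof.
move=> hE [N [c0 Fc]] EF i; apply: contrapT => Ec.
have [f [flin fE fc]] := separating_functional hE Ec.
have iN : (i < N)%N.
  by rewrite ltnNge; apply/negP => /c0 ci0; apply: Ec; rewrite ci0; apply: hE.1.
pose p : {poly k} := \poly_(j < N) f (c j).
have fL : linear (f : V -> k^o) by exact: flin.
have fsum (n : nat) : p.[n%:R] = 0.
  rewrite -(fE (F n)) // Fc horner_poly (lin_sum _ _ _ fL).
  by apply: eq_bigr => j _; rewrite (linZ fL) mulrC.
have p0 : p != 0.
  apply: contraTneq (oner_neq0 k) => p0.
  by rewrite -fc; have := coef_poly N (f \o c) i; rewrite iN /= => <-; rewrite
    -/p p0 coef0 eqxx.
have := @max_poly_roots _ p [seq n%:R | n <- iota 0 (size p)] p0.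
rewrite size_map size_iota ltnn => /(_ _ _)/negP; apply=> //.
  by apply/allP => _ /mapP[n _ ->]; apply/rootP/fsum.
by rewrite map_inj_uniq ?iota_uniq //; apply: natr_inj.
Qed.

Lemma expansion_uniq F G c d :
  expansion F c -> expansion G d -> F =1 G -> c =1 d.
Proof.
move=> hc hd FG i; apply/eqP; rewrite -subr_eq0 -scaleN1r addrC; apply/eqP.
have hE : lin_closed (fun v : V => v = 0).
  by split=> // a x y -> ->; rewrite scaler0 addr0.
apply: (expansion_mem hE (expansion_lin (-1) hd hc)) => n /=.
by rewrite FG scaleN1r addNr.
Qed.

End OneSpace.

Lemma expansion_linear (V W : lmodType k) (f : V -> W) F c :
  linear f -> expansion F c -> expansion (f \o F) (f \o c).
Proof.
move=> hf [N [c0 Fc]]; exists N; split=> [i /c0 /= ->|n /=]; first exact: lin0.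
by rewrite Fc lin_sum //; apply: eq_bigr => i _; apply: linZ.
Qed.

(** The Cauchy product, by induction on the degree of F through Horner's
    F(n) = c_0 + n F'(n). *)
Lemma expansion_bilinear (V W X : lmodType k) (B : V -> W -> X) F c G d :
  bilinear_for *:%R *:%R B -> expansion F c -> expansion G d ->
  expansion (fun n => B (F n) (G n))
            (fun r => \sum_(i < r.+1) B (c i) (d (r - i)%N)).
Proof.
move=> hB [N [c0 Fc]] hG; elim: N F c c0 Fc => [|N IH] F c c0 Fc.
  apply: eq_expansion (expansion0 X) => n.
    by rewrite Fc big_ord0 (bilin0l hB).
  by rewrite big1 // => i _; rewrite c0 // (bilin0l hB).
pose F' n := \sum_(i < N) n%:R ^+ i *: c i.+1.
have FE n : F n = c 0 + n%:R *: F' n.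
  rewrite Fc big_ord_recl expr0 scale1r scaler_sumr; congr (_ + _).
  by apply: eq_bigr => i _; rewrite scalerA -exprS.
have c0' i : (N <= i)%N -> c i.+1 = 0 by move=> Ni; apply: c0.
have h1 := expansion_linear (hB.2 (c 0)) hG.
have h2 := expansion_shift (IH F' (c \o S) c0' (fun=> erefl)).
apply: eq_expansion (expansionD h1 h2) => [n|r] /=.
  by rewrite FE (bilinDl hB) (bilinZl hB).
by rewrite big_ord_recl subn0; case: r => [|r]; rewrite ?big_ord0 ?addr0.
Qed.

End Expansions.

(** * The convolution ring *)

(** The coproduct of H will be written as a convolution product of maps into
    H (x) H, which therefore has to be an algebra; the counits show that it is
    not the zero ring. *)
Section TensorOfBialgebras.
Variables (k : fieldType) (A B : bialgType k).

Lemma tensor_oner_neq0 : (1 : tensor A B) != 0.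
Proof.
have hf : bilinear_for *:%R *:%R
    (fun (a : A) (b : B) => counit a * counit b : k^o).
  apply: bilinI => [b l x y|a l x y] /=; rewrite counit_linear.
    by rewrite mulrDl -mulrA.
  by rewrite mulrDr mulrCA.
apply: contra_neq (oner_neq0 k); rewrite tensor_oneE => e.
have := tlift_pure hf 1 1; rewrite e (tlift0 hf) !counit1 mulr1.
by move=> ->.
Qed.

HB.instance Definition _ :=
  GRing.PzSemiRing_isNonZero.Build (tensor A B) tensor_oner_neq0.
HB.instance Definition _ :=
  GRing.LSemiModule_isLSemiAlgebra.Build k (tensor A B) (@tensor_scalerAl k A B).
HB.instance Definition _ :=
  GRing.LSemiAlgebra_isSemiAlgebra.Build k (tensor A B) (@tensor_scalerAr k A B).

End TensorOfBialgebras.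

(** Linear maps from a coalgebra to an algebra, as a type of its own so that
    it can carry the convolution product. *)
Record conv (k : fieldType) (C : coalgType k) (A : algType k) :=
  Conv { conv_fun :> C -> A; conv_linear : linear conv_fun }.

Section ConvolutionRing.
Variables (k : fieldType) (C : coalgType k) (A : algType k).
Implicit Types f g h : conv C A.

HB.instance Definition _ := gen_eqMixin (conv C A).
HB.instance Definition _ := gen_choiceMixin (conv C A).

Lemma eq_conv f g : f =1 g -> f = g.
Proof.
case: f g => [f hf] [g hg] /= /funext fg; move: hf hg; rewrite fg => hf hg.
by congr Conv; apply: Prop_irrelevance.
Qed.

Lemma conv_zero_subproof : linear (fun _ : C => 0 : A).
Proof. by move=> a x y; rewrite scaler0 addr0. Qed.
Lemma conv_add_subproof f g : linear (fun x => f x + g x).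
Proof. by move=> a x y; rewrite !conv_linear scalerDr addrACA. Qed.
Lemma conv_opp_subproof f : linear (fun x => - f x).
Proof. by move=> a x y; rewrite conv_linear opprD scalerN. Qed.

Definition conv_zero := Conv conv_zero_subproof.
Definition conv_add f g := Conv (conv_add_subproof f g).
Definition conv_opp f := Conv (conv_opp_subproof f).

Fact conv_addA : associative conv_add.
Proof. by move=> f g h; apply: eq_conv => x; apply: addrA. Qed.
Fact conv_addC : commutative conv_add.
Proof. by move=> f g; apply: eq_conv => x; apply: addrC. Qed.
Fact conv_add0 : left_id conv_zero conv_add.
Proof. by move=> f; apply: eq_conv => x; apply: add0r. Qed.
Fact conv_addN : left_inverse conv_zero conv_opp conv_add.
Proof. by move=> f; apply: eq_conv => x; apply: addNr. Qed.

HB.instance Definition _ :=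
  GRing.isZmodule.Build (conv C A) conv_addA conv_addC conv_add0 conv_addN.

Lemma conv_one_subproof : linear (fun x : C => (counit x)%:A : A).
Proof. by move=> a x y; rewrite counit_linear scalerDl scalerA. Qed.
Lemma conv_mul_subproof f g :
  linear (fun x => tlift (fun a b => f a * g b) (comul x)).
Proof.
have hfg := mul_bilinear (@conv_linear _ _ _ f) (@conv_linear _ _ _ g).
by move=> a x y; rewrite comul_linear (tlift_linear hfg).
Qed.

Definition conv_one := Conv conv_one_subproof.
Definition conv_mul f g := Conv (conv_mul_subproof f g).

Fact conv_mulA : associative conv_mul.
Proof.
move=> f g h; apply: eq_conv => x.
have hfg := mul_bilinear (@conv_linear _ _ _ f) (@conv_linear _ _ _ g).
have hgh := mul_bilinear (@conv_linear _ _ _ g) (@conv_linear _ _ _ h).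
have lgh := tlift_linear hgh.
have hT := mul_bilinear (@conv_linear _ _ _ f) lgh.
pose T : tensor C (tensor C C) -> A :=
  tlift (fun a u => f a * tlift (fun b c => g b * h c) u).
have TL : linear T by exact: tlift_linear.
have TP u t : T (u \ox t) = f u * tlift (fun b c => g b * h c) t.
  exact: tlift_pure.
have il : linear (id : C -> C) by [].
have cl := @comul_linear k C.
have mlr := tmap_linear il cl.
have mll := tmap_linear cl il.
have al := @tassoc_linear k C C C.
transitivity (T (tmap id comul (comul x))).
  have h1 := mul_bilinear (@conv_linear _ _ _ f) (conv_mul_subproof g h).
  apply: (linear_eq_tensor (tlift_linear h1) (linear_comp mlr TL)) => a b.
  by rewrite (tlift_pure h1) /= tmap_pure // TP.
rewrite -comulA /=.
have h2 := mul_bilinear (conv_mul_subproof f g) (@conv_linear _ _ _ h).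
symmetry; apply: (linear_eq_tensor (tlift_linear h2)
  (linear_comp mll (linear_comp al TL))) => a b.
rewrite (tlift_pure h2) /= tmap_pure //.
elim/tensor_ind: (comul a) => [c d|s t IHs IHt].
  rewrite (tlift_pure hfg) tassoc_pure TP (tlift_pure hgh).
  by rewrite mulrA.
by rewrite (tliftD hfg) mulrDl IHs IHt tpureDl (linD al) (linD TL).
Qed.

Fact conv_mul1l : left_id conv_one conv_mul.
Proof.
move=> f; apply: eq_conv => x /=; rewrite -[in RHS](counitl x).
have hb := scale_bilinear_left C (@counit_linear k C).
have hf := mul_bilinear conv_one_subproof (@conv_linear _ _ _ f).
have fL := linear_comp (tlift_linear hb) (@conv_linear _ _ _ f).
apply: (linear_eq_tensor (tlift_linear hf) fL) => a b.
by rewrite (tlift_pure hf) /= (tlift_pure hb) (linZ (@conv_linear _ _ _ f))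
  -scalerAl mul1r.
Qed.

Fact conv_mul1r : right_id conv_one conv_mul.
Proof.
move=> f; apply: eq_conv => x /=; rewrite -[in RHS](counitr x).
have hb := scale_bilinear_right C (@counit_linear k C).
have hf := mul_bilinear (@conv_linear _ _ _ f) conv_one_subproof.
have fL := linear_comp (tlift_linear hb) (@conv_linear _ _ _ f).
apply: (linear_eq_tensor (tlift_linear hf) fL) => a b.
by rewrite (tlift_pure hf) /= (tlift_pure hb) (linZ (@conv_linear _ _ _ f))
  -scalerAr mulr1.
Qed.

Fact conv_mulDl : left_distributive conv_mul conv_add.
Proof.
move=> f g h; apply: eq_conv => x /=; rewrite -[X in X + _]scale1r.
by apply: tlift_comb => a b; rewrite scale1r mulrDl.
Qed.
Fact conv_mulDr : right_distributive conv_mul conv_add.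
Proof.
move=> f g h; apply: eq_conv => x /=; rewrite -[X in X + _]scale1r.
by apply: tlift_comb => a b; rewrite scale1r mulrDr.
Qed.

HB.instance Definition _ := GRing.Zmodule_isPzRing.Build (conv C A)
  conv_mulA conv_mul1l conv_mul1r conv_mulDl conv_mulDr.

Lemma convM f g x : (f * g) x = tlift (fun a b => f a * g b) (comul x).
Proof. by []. Qed.
Lemma conv1 x : (1 : conv C A) x = (counit x)%:A.
Proof. by []. Qed.
Lemma convD f g x : (f + g) x = f x + g x.
Proof. by []. Qed.
Lemma convN f x : (- f) x = - f x.
Proof. by []. Qed.
Lemma convMn f n x : (f *+ n) x = f x *+ n.
Proof. by elim: n => [|n IH] //; rewrite !mulrSr convD IH. Qed.
Lemma conv_sum (I : Type) (r : seq I) (F : I -> conv C A) x :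
  (\sum_(i <- r) F i) x = \sum_(i <- r) F i x.
Proof. by elim/big_ind2: _ => // f1 x1 f2 x2 <- <-. Qed.

End ConvolutionRing.

Lemma comul_sum (k : fieldType) (C : coalgType k) (x : C) :
  exists n (a b : 'I_n -> C), comul x = \sum_i a i \ox b i.
Proof.
elim/tensor_ind: (comul x) => [a b|s t [m [a [b ->]]] [n [c [d ->]]]].
  by exists 1, (fun=> a), (fun=> b); rewrite big_ord1.
pose cat (e : 'I_m -> C) (f : 'I_n -> C) i :=
  match split i with inl j => e j | inr j => f j end.
exists (m + n)%N, (cat a c), (cat b d); rewrite big_split_ord /cat.
congr (_ + _); apply: eq_bigr => i _.
  by rewrite (unsplitK (inl i)).
by rewrite (unsplitK (inr i)).
Qed.

(** * Conilpotency of connected cocommutative bialgebras *)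

Section DualAction.
Variables (k : fieldType) (C : coalgType k).
Implicit Types (f g p q : C -> k) (x y z e : C).

(** The action f.x = x_1 f(x_2) of functionals; for a cocommutative coalgebra
    its invariant subspaces are the subcoalgebras. *)
Definition act f x : C := tlift (fun a b => f b *: a) (comul x).

Lemma act_linear f : scalar f -> linear (act f).
Proof.
by move=> hf a x y; rewrite /act comul_linear (tlift_linear (scale_bilinear_right C hf)).
Qed.

Lemma act_comb a f g x : act (fun y => a * f y + g y) x = a *: act f x + act g x.
Proof. by apply: tlift_comb => u v; rewrite scalerDl scalerA. Qed.

Lemma act_counit x : act counit x = x.
Proof. exact: counitr. Qed.

Lemma actE f x e b0 n (a b : 'I_n -> C) : scalar f ->
  comul x = e \ox b0 + \sum_i a i \ox b i ->
  act f x = f b0 *: e + \sum_i f (b i) *: a i.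
Proof.
move=> hf E; rewrite /act E (tliftD (scale_bilinear_right C hf)).
have hb := scale_bilinear_right C hf.
by rewrite (tlift_pure hb) (tlift_sum _ _ hb).
Qed.

Lemma comul_act f x : scalar f ->
  comul (act f x) = tmap id (act f) (comul x).
Proof.
move=> hf; have hb := scale_bilinear_right C hf; have il : linear (id : C -> C) by [].
have cl := @comul_linear k C; have fl := act_linear hf.
pose T : tensor C (tensor C C) -> tensor C C := tmap id (tlift (fun a b => f b *: a)).
have TL : linear T := tmap_linear il (tlift_linear hb).
have -> : tmap id (act f) (comul x) = T (tmap id comul (comul x)).
  elim/tensor_ind: (comul x) => [a b|s t IHs IHt].
    by rewrite /T !tmap_pure //; apply: tlift_linear.
  rewrite (linD (tmap_linear il fl)) IHs IHt.
  by rewrite (linD (tmap_linear il cl)) (linD TL).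
rewrite -comulA /act.
elim/tensor_ind: (comul x) => [a b|s t IHs IHt]; last first.
  rewrite (tliftD hb) (linD cl) IHs IHt (linD (tmap_linear cl il)).
  by rewrite (linD (@tassoc_linear k C C C)) (linD TL).
rewrite (tlift_pure hb) (linZ cl) tmap_pure //.
elim/tensor_ind: (comul a) => [c d|s t IHs IHt].
  rewrite tassoc_pure /T tmap_pure // ?(tlift_pure hb) ?tpureZr //.
  exact: tlift_linear.
rewrite tpureDl (linD (@tassoc_linear k C C C)) (linD TL) -IHs -IHt.
by rewrite scalerDr.
Qed.

Lemma comul_actE f x e b0 n (a b : 'I_n -> C) : scalar f ->
  comul x = e \ox b0 + \sum_i a i \ox b i ->
  comul (act f x) = e \ox act f b0 + \sum_i a i \ox act f (b i).
Proof.
move=> hf E; have il : linear (id : C -> C) by [].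
have tl := tmap_linear il (act_linear hf).
rewrite comul_act // E (linD tl) tmap_pure ?(lin_sum _ _ _ tl) //; last exact: act_linear.
by congr (_ + _); apply: eq_bigr => i _; rewrite tmap_pure //; apply: act_linear.
Qed.

Lemma scalar_act f g : scalar f -> scalar g -> scalar (fun x => f (act g x)).
Proof. by move=> hf hg a x y; rewrite (act_linear hg) hf. Qed.

Lemma act_act f g x : scalar f -> scalar g ->
  act f (act g x) = act (fun y => f (act g y)) x.
Proof.
move=> hf hg; have [n [a [b E]]] := comul_sum x.
have {}E : comul x = 0 \ox 0 + \sum_i a i \ox b i by rewrite tpure0l add0r.
rewrite (actE hf (comul_actE hg E)) (actE _ E) //; exact: scalar_act.
Qed.

Section Cocommutative.
Hypothesis cocomm : cocommutative C.

Lemma act_swapE f x e b0 n (a b : 'I_n -> C) : scalar f ->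
  comul x = e \ox b0 + \sum_i a i \ox b i ->
  act f x = f e *: b0 + \sum_i f (a i) *: b i.
Proof.
move=> hf E; apply: actE => //; rewrite -cocomm E (linD (@tswap_linear k C C)).
rewrite tswap_pure (lin_sum _ _ _ (@tswap_linear k C C)); congr (_ + _).
by apply: eq_bigr => i _; rewrite tswap_pure.
Qed.

Lemma pair_actC f g x : scalar f -> scalar g -> f (act g x) = g (act f x).
Proof.
move=> hf hg; have [n [a [b E]]] := comul_sum x.
have {}E : comul x = 0 \ox 0 + \sum_i a i \ox b i by rewrite tpure0l add0r.
rewrite (actE hg E) (act_swapE hf E) !scaler0 !add0r !scalar_sum //.
by apply: eq_bigr => i _; rewrite !scalarZ // mulrC.
Qed.

Lemma actC f g x : scalar f -> scalar g -> act f (act g x) = act g (act f x).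
Proof.
move=> hf hg; rewrite !act_act //; apply: eq_tlift => a b.
by rewrite pair_actC.
Qed.

End Cocommutative.

(** The vector e selects what is counted: e = 0 gives the rank of the tensor
    Delta(x), and a grouplike e = 1 gives its rank modulo 1 (x) C. *)
Definition comul_rank_le e n x := exists b0 (a b : 'I_n -> C),
  comul x = e \ox b0 + \sum_i a i \ox b i.

Lemma least_nat (P : nat -> Prop) n : P n ->
  exists m, P m /\ forall l, (l < m)%N -> ~ P l.
Proof.
move=> Pn; have ex : exists m, `[< P m >] by exists n; apply/asboolP.
exists (ex_minn ex); case: ex_minnP => m /asboolP Pm mmin; split=> // l lm Pl.
by have /mmin := asboolT Pl; rewrite leqNgt lm.
Qed.

Lemma comul_rank_exists e x : exists n, comul_rank_le e n x.
Proof.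
have [n [a [b E]]] := comul_sum x.
by exists n, 0, a, b; rewrite tpure0r add0r.
Qed.

Section MinimalRank.
Variables (e x b0 : C) (n : nat) (a b : 'I_n -> C).
Hypothesis E : comul x = e \ox b0 + \sum_i a i \ox b i.
Hypothesis nmin : forall l, (l < n)%N -> ~ comul_rank_le e l x.

(** If b_j were a combination of the other b_i, the j-th pure tensor could be
    distributed over the others, contradicting minimality. *)
Lemma minimal_rank_dual_right j :
  exists f, [/\ scalar f, f (b j) = 1 & forall i, i != j -> f (b i) = 0].
Proof.
case: n a b j E nmin => [|m] a' b' j E' min; first by case: j.
pose G y := exists i : 'I_m, y = b' (lift j i).
have [|f [hf fG fj]] := @separating_functional k C (span G) (b' j) (span_closed G).
  case/(@span_img k C m (fun i => b' (lift j i))) => c bj.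
  apply: (min m (leqnn _)).
  exists b0, (fun i => a' (lift j i) + c i *: a' j), (fun i => b' (lift j i)).
  rewrite E' (bigD1_ord j) //=; congr (_ + _).
  rewrite [X in _ \ox X]bj (lin_sum _ _ _ (@tpure_linear_right k C C (a' j))).
  rewrite -big_split; apply: eq_bigr => i _ /=.
  by rewrite tpureDl tpureZl tpureZr addrC.
exists f; split=> // i; case: (unliftP j i) => [l -> _|->]; last by rewrite eqxx.
by apply: fG; apply: span_gen; exists l.
Qed.

(** As on the right side; here a multiple of e is absorbed into the term
    e (x) b_0 at no cost, so g can be chosen to vanish on e as well. *)
Lemma minimal_rank_dual_left j :
  exists g, [/\ scalar g, g e = 0, g (a j) = 1 & forall i, i != j -> g (a i) = 0].
Proof.
case: n a b j E nmin => [|m] a' b' j E' min; first by case: j.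
pose d (i : 'I_m.+1) := if unlift ord0 i is Some l then a' (lift j l) else e.
pose G y := exists i, y = d i.
have [|f [hf fG fj]] := @separating_functional k C (span G) (a' j) (span_closed G).
  case/(@span_img k C m.+1 d) => c aj.
  apply: (min m (leqnn _)).
  exists (b0 + c ord0 *: b' j), (fun i => a' (lift j i)),
    (fun i => b' (lift j i) + c (lift ord0 i) *: b' j).
  rewrite E' (bigD1_ord j) //= [X in X \ox b' j]aj big_ord_recl.
  rewrite {1}/d unlift_none tpureDl tpureZl -tpureZr tpureDr -!addrA.
  congr (_ + (_ + _)).
  rewrite (lin_sum _ _ _ (@tpure_linear_left k C C (b' j))).
  rewrite -big_split; apply: eq_bigr => i _ /=.
  by rewrite /d liftK tpureDr tpureZl tpureZr addrC.
exists f; split=> //.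
  by apply: fG; apply: span_gen; exists ord0; rewrite /d unlift_none.
move=> i; case: (unliftP j i) => [l -> _|->]; last by rewrite eqxx.
by apply: fG; apply: span_gen; exists (lift ord0 l); rewrite /d liftK.
Qed.

End MinimalRank.

Definition orbit z y := exists2 p, scalar p & y = act p z.

Lemma orbit_closed z : lin_closed (orbit z).
Proof.
have s0 : scalar (fun _ : C => 0 : k) by move=> a u v; rewrite mulr0 addr0.
split=> [|a _ _ [p hp ->] [q hq ->]].
  exists (fun=> 0) => //; have [n [a [b E]]] := comul_sum z.
  have {}E : comul z = 0 \ox 0 + \sum_i a i \ox b i by rewrite tpure0l add0r.
  rewrite (actE s0 E) scaler0 add0r big1 // => i _; exact: scale0r.
exists (fun y => a * p y + q y); last by rewrite act_comb.
by move=> l u v; rewrite hp hq !mulrDr !mulrA [l * a]mulrC addrACA.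
Qed.

Lemma orbit_act z f y : scalar f -> orbit z y -> orbit z (act f y).
Proof.
move=> hf [p hp ->]; exists (fun x => f (act p x)); first exact: scalar_act.
exact: act_act.
Qed.

(** Delta(f.x) = e (x) f.b_0 + sum_i a_i (x) f.b_i is then minimal too, so the
    functionals dual to the f.b_i recover every a_i from f.x up to multiples
    of e, and x is a combination of e and the a_i. *)
Lemma minimal_rank_recover e x n f : scalar f -> comul_rank_le e n x ->
  (forall l, (l < n)%N -> ~ comul_rank_le e l (act f x)) ->
  exists2 y, orbit (act f x) y & exists c, x = y + c *: e.
Proof.
move=> hf [b0 [a [b E]]] nmin.
pose W v := exists2 y, orbit (act f x) y & exists c, v = y + c *: e.
have hO := orbit_closed (act f x).
have hW : lin_closed W.
  split=> [|l _ _ [y hy [c ->]] [z hz [d ->]]].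
    by exists 0; [apply: hO.1|exists 0; rewrite scale0r addr0].
  exists (l *: y + z); first exact: hO.2.
  by exists (l * c + d); rewrite scalerDr scalerDl scalerA addrACA.
rewrite -/(W x) -[x]act_counit (actE (@counit_linear k C) E).
apply: lin_closedD => //.
  exists 0; first exact: hO.1.
  by exists (counit b0); rewrite add0r.
apply: lin_closed_sum => // j _; apply: lin_closedZ => //.
have E' := comul_actE hf E.
have [p [hp pj p0]] := minimal_rank_dual_right E' nmin j.
exists (act p (act f x)); first by exists p.
exists (- p (act f b0)); rewrite (actE hp E') (bigD1 j) //= pj scale1r big1.
  by rewrite addr0 scaleNr addrAC subrr add0r.
by move=> i ij; rewrite p0 // scale0r.
Qed.

Section Subcoalgebras.
Hypothesis cocomm : cocommutative C.

(** In a minimal expression Delta(x) = sum_i a_i (x) b_i, the dual functionals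
    exhibit both the a_i and, by cocommutativity, the b_i as elements of the
    orbit of x. *)
Lemma act_closed_subcoalgebra (F : C -> Prop) : lin_closed F ->
  (forall f x, scalar f -> F x -> F (act f x)) -> subcoalgebra F.
Proof.
move=> hF Fact; split=> // x Fx; have [l xl] := comul_rank_exists 0 x.
have [m [[b0 [a [b E]]] mmin]] := @least_nat (fun i => comul_rank_le 0 i x) l xl.
exists [seq (a i, b i) | i <- enum 'I_m]; last first.
  by rewrite E tpure0l add0r big_map big_enum.
move=> _ /mapP[j _ ->]; split=> /=.
  have [f [hf fj f0]] := minimal_rank_dual_right E mmin j.
  have := Fact f x hf Fx; rewrite (actE hf E) scaler0 add0r (bigD1 j) //= fj.
  by rewrite scale1r big1 ?addr0 // => i /f0 ->; rewrite scale0r.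
have [g [hg ge gj g0]] := minimal_rank_dual_left E mmin j.
have := Fact g x hg Fx; rewrite (act_swapE cocomm hg E) ge scale0r add0r.
rewrite (bigD1 j) //= gj.
by rewrite scale1r big1 ?addr0 // => i /g0 ->; rewrite scale0r.
Qed.

Lemma subcoalgebra_act (F : C -> Prop) f x :
  subcoalgebra F -> scalar f -> F x -> F (act f x).
Proof.
move=> [hF Fc] hf Fx; have [s sF E] := Fc x Fx.
have hb := scale_bilinear_right C hf.
rewrite /act E (lin_sum _ _ _ (tlift_linear hb)) big_seq.
apply: lin_closed_sum => // p ps; rewrite (tlift_pure hb).
by apply: lin_closedZ => //; case: (sF p ps).
Qed.

(** A nonzero y of least rank in the orbit of x works: any nonzero z = p.y has
    the same rank, so y lies in the orbit of z. *)
Lemma simple_orbit x : x <> 0 ->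
  exists2 y, orbit x y & y <> 0 /\ simple_subcoalgebra (orbit y).
Proof.
move=> x0.
pose P n := exists2 y, orbit x y & y <> 0 /\ comul_rank_le 0 n y.
have [n0 Pn0] : exists n, P n.
  have [n hn] := comul_rank_exists 0 x; exists n, x => //.
  by exists counit; [apply: counit_linear|rewrite act_counit].
have [n [[y xy [y0 yn]] nmin]] := @least_nat P n0 Pn0.
exists y => //; split=> //.
have oy : orbit y y.
  by exists counit; [apply: counit_linear|rewrite act_counit].
split.
- apply: act_closed_subcoalgebra; first exact: orbit_closed.
  by move=> f z hf; apply: orbit_act.
- by exists y.
move=> F hF Fy; have [F0|] := pselect (forall z, F z -> z = 0); first by left.
move=> /existsNP[z /not_implyP[Fz z0]]; right.
have Fa f u : scalar f -> F u -> F (act f u) by apply: subcoalgebra_act.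
have [p hp zE] := Fy z Fz.
have [|w [q hq ->] [c yE]] := minimal_rank_recover hp yn.
  move=> l ln hl; apply: (nmin l ln); exists (act p y); first exact: orbit_act.
  by rewrite -zE in hl *.
move=> _ [r hr ->]; apply: (Fa r) => //.
by rewrite yE scaler0 addr0 -zE; apply: Fa.
Qed.

End Subcoalgebras.
End DualAction.

Section Conilpotency.
Variables (k : fieldType) (H : bialgType k).
Hypotheses (cocomm : cocommutative H) (conn : connected H).

Lemma act_one (f : H -> k) : scalar f -> act f 1 = (f 1)%:A.
Proof.
move=> hf; rewrite /act comul1 tensor_oneE tlift_pure //.
exact: scale_bilinear_right.
Qed.

(** The orbit of x contains a simple subcoalgebra, and connectedness leaves
    only the line through 1. *)
Lemma orbit_one (x : H) : x <> 0 -> orbit x 1.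
Proof.
move=> /(simple_orbit cocomm)[y xy [y0 ys]].
have [a ya] : exists a : k, y = a%:A.
  apply/conn; exists [:: y]; last by rewrite big_seq1.
  move=> z; rewrite inE => /eqP ->; exists (orbit y) => //.
  by exists counit; [apply: counit_linear|rewrite act_counit].
have a0 : a != 0 by apply/eqP=> a0; apply: y0; rewrite ya a0 scale0r.
rewrite -[1]scale1r -(mulVf a0) -scalerA -ya.
by have := lin_closedZ (orbit_closed x) a^-1 xy.
Qed.

(** If f.x is nonzero of undiminished rank, then x = r.f.x for some r, as 1 is
    in the orbit of f.x.  The action is commutative and 1 = q.x for some q, so
    1 = q.x = q.r.f.x = r.f.q.x = r.f.1 = 0. *)
Lemma comul_rank_act_lt (x : H) n f : scalar f -> f 1 = 0 -> comul_rank_le 1 n x ->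
  act f x = 0 \/ exists2 l, (l < n)%N & comul_rank_le 1 l (act f x).
Proof.
move=> hf f1 xn; have [|z0] := pselect (act f x = 0); [by left|right].
apply: contrapT => nl.
have [|y zy [c xE]] := minimal_rank_recover hf xn.
  by move=> l ln hl; apply: nl; exists l.
have x0 : x <> 0.
  by move=> x0; apply: z0; rewrite x0 (lin0 (act_linear hf)).
have [r hr xr] : orbit (act f x) x.
  have hO := orbit_closed (act f x).
  by rewrite [X in orbit _ X]xE; apply:
    (lin_closedD hO zy (lin_closedZ hO c (orbit_one z0))).
have [q hq q1] := orbit_one x0.
have hh := scalar_act hr hf; rewrite act_act // in xr.
have := oner_neq0 H; rewrite q1 xr actC // -q1 act_one // act_one // f1.
by rewrite scale0r (scalar0 hr) scale0r eqxx.
Qed.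

(** Quantifying over all target algebras at once provides a bound N that serves
    both for maps into H and for maps into U(P(H)). *)
Definition conilpotent_at (x : H) N := forall (A : algType k) (J : conv H A),
  J 1 = 0 -> forall n, (N <= n)%N -> (J ^+ n) x = 0.

(** Write Delta(x) = 1 (x) b_0 + sum_i a_i (x) b_i minimally.  Since J(1) = 0,
    J^(m+1)(x) = sum_i J(a_i) J^m(b_i), and b_i = g_i.x for a functional g_i
    that kills 1, so b_i is zero or has smaller rank than x. *)
Lemma comul_rank_conilpotent n x : comul_rank_le 1 n x -> conilpotent_at x n.+1.
Proof.
elim/ltn_ind: n x => n IH x xn A J J1 [//|m] nm.
have [l [[b0 [a [b E]]] lmin]] := @least_nat (fun i => comul_rank_le 1 i x) n xn.
have ln : (l <= n)%N by rewrite leqNgt; apply/negP => /lmin; apply.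
have hb := mul_bilinear (@conv_linear _ _ _ J) (@conv_linear _ _ _ (J ^+ m)).
rewrite exprS convM E (tliftD hb) (tlift_pure hb) J1 mul0r add0r.
rewrite (tlift_sum _ _ hb) big1 // => j _.
suff -> : (J ^+ m) (b j) = 0 by rewrite mulr0.
have [g [hg ge gj g0]] := minimal_rank_dual_left E lmin j.
have <- : act g x = b j.
  rewrite (act_swapE cocomm hg E) ge scale0r add0r (bigD1 j) //= gj.
  by rewrite scale1r big1 ?addr0 // => i /g0 ->; rewrite scale0r.
have xl : comul_rank_le 1 l x by exists b0, a, b.
case: (comul_rank_act_lt hg ge xl) => [->|[i il hi]].
  exact/lin0/conv_linear.
apply: (IH i (leq_trans il ln)) => //.
by apply: leq_trans il (leq_trans ln _).
Qed.

Definition conilpotent := forall x, exists N, conilpotent_at x N.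

Lemma connected_conilpotent : conilpotent.
Proof.
by move=> x; have [n hn] := comul_rank_exists 1 x; exists n.+1;
  apply: comul_rank_conilpotent.
Qed.

End Conilpotency.

Arguments conilpotent {k} H.

(** * Convolution powers of the identity and their logarithm *)

Section PostComposition.
Variables (k : fieldType) (C : coalgType k) (A B : algType k) (f : A -> B).
Hypotheses (f_lin : linear f) (f1 : f 1 = 1) (fM : {morph f : x y / x * y}).

Lemma conv_post_subproof (u : conv C A) : linear (fun x => f (u x)).
Proof. by move=> a x y; rewrite conv_linear f_lin. Qed.
Definition conv_post u : conv C B := Conv (conv_post_subproof u).

Lemma conv_postX u n : conv_post (u ^+ n) = conv_post u ^+ n.
Proof.
elim: n => [|n IH].
  by apply: eq_conv => x; rewrite /= (linZ f_lin) f1.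
rewrite !exprS -IH; apply: eq_conv => x; rewrite -[LHS]/(f ((u * u ^+ n) x)) !convM.
have hb (D : algType k) (p q : conv C D) :=
  mul_bilinear (@conv_linear _ _ _ p) (@conv_linear _ _ _ q).
elim/tensor_ind: (comul x) => [a b|s t IHs IHt].
  by rewrite (tlift_pure (hb _ u (u ^+ n)))
    (tlift_pure (hb _ (conv_post u) (conv_post (u ^+ n)))) fM.
by rewrite (tliftD (hb _ _ _)) (linD f_lin) IHs IHt (tliftD (hb _ _ _)).
Qed.

End PostComposition.

Section Primitives.
Variables (k : fieldType) (H : bialgType k) (c : H).
Hypothesis hc : c \in primitive.

(** The binomial formula: c (x) 1 and 1 (x) c commute. *)
Lemma comul_primitiveX n :
  comul (c ^+ n) = \sum_(i < n.+1) c ^+ (n - i) \ox (c ^+ i *+ 'C(n, i)).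
Proof.
have tX (a b : H) m : (a \ox b) ^+ m = a ^+ m \ox b ^+ m.
  by elim: m => [|m IH]; rewrite ?exprS ?IH ?tpureM.
have -> : comul (c ^+ n) = comul c ^+ n.
  by elim: n => [|n IH]; rewrite ?comul1 // !exprS comulM IH.
rewrite (primitiveP _ hc) exprDn_comm; last first.
  by rewrite /GRing.comm !tpureM !(mul1r, mulr1).
apply: eq_bigr => i _; rewrite !tX !expr1n tpureM mulr1 mul1r.
by rewrite -!(scaler_nat (R := k)) tpureZr.
Qed.

Lemma counit_primitive : counit c = 0.
Proof.
have hb := scale_bilinear_left H (@counit_linear k H).
have := counitl c; rewrite (primitiveP _ hc) (tliftD hb) !(tlift_pure hb) counit1.
rewrite scale1r => /eqP; rewrite -subr_eq0 addrK => /eqP c1.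
apply/eqP; have := oner_neq0 k; apply: contraNT => c0.
by rewrite -(@counit1 k H) -[1]scale1r -(mulVf c0) -scalerA c1 scaler0 scalar0 //;
  apply: counit_linear.
Qed.

(** In the binomial expansion of Delta(c^n), one application of f to the left
    factor keeps only c (x) n c^(n-1), so f^j(c^n) = n u f^(j-1)(c^(n-1)). *)
Lemma conv_primitiveX (A : algType k) (f : conv H A) (u : A) j n :
  (forall m, f (c ^+ m) = if m == 1%N then u else 0) ->
  (f ^+ j) (c ^+ n) = if j == n then u ^+ n *+ n`! else 0.
Proof.
move=> fc; elim: j n => [|j IH] n.
  rewrite conv1; case: n => [|n]; first by rewrite counit1 scale1r.
  by rewrite exprS counitM counit_primitive mul0r scale0r.
have hb := mul_bilinear (@conv_linear _ _ _ f) (@conv_linear _ _ _ (f ^+ j)).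
rewrite exprS convM comul_primitiveX (tlift_sum _ _ hb).
case: n => [|n]; first by rewrite big_ord1 subn0 fc mul0r.
rewrite !big_ord_recr /= subnn (fc 0%N) mul0r addr0 subSnn (fc 1%N) /=.
rewrite big1 ?add0r => [|i _]; last first.
  by rewrite fc subSn 1?ltnW // eqSS subn_eq0 leqNgt ltn_ord mul0r.
rewrite -(scaler_nat (R := k)) (linZ (@conv_linear _ _ _ _)) IH eqSS.
case: eqP => [_|_]; last by rewrite scaler0 mulr0.
by rewrite binSn scaler_nat mulrnAr mulrnAr -exprS -mulrnA mulnC -factS.
Qed.

End Primitives.

Section AdamsOperations.
Variables (k : fieldType) (H : bialgType k).
Hypotheses (char0 : [pchar k] =i pred0) (cocomm : cocommutative H).
Hypothesis conil : conilpotent H.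

Definition conv_id : conv H H := Conv (@id_linear k H).
Local Notation Psi n := (conv_id ^+ n).

Lemma pnatr_neq0 n : n.+1%:R != 0 :> k.
Proof. by have /pcharf0P -> := char0. Qed.

Lemma expansion_binomial (V : lmodType k) (v : V) j :
  exists c, expansion (fun n => 'C(n, j)%:R *: v) c.
Proof.
elim: j => [|j [c hc]].
  eexists; apply: eq_expansion (expansion_cst v) => [n|i]; last reflexivity.
  by rewrite bin0 scale1r.
have hd := expansionZ j.+1%:R^-1 (expansion_lin (- j%:R) hc (expansion_shift hc)).
eexists; apply: eq_expansion hd => [n|i]; last reflexivity.
rewrite !scalerA -scalerDl scalerA.
congr (_ *: _); apply: (mulfI (pnatr_neq0 j)); rewrite mulrA divff ?pnatr_neq0 //.
rewrite mul1r -mulrDl -[RHS]natrM mul_bin_left natrM addrC.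
case: (leqP j n) => [jn|nj]; first by rewrite natrB.
by rewrite (bin_small nj) !mulr0.
Qed.

(** With J = id - 1, Psi^n = (1 + J)^n = sum_i C(n, i) J^i is a finite sum at x,
    and the binomial coefficients are polynomial in n. *)
Lemma adams_expansion_exists x : exists c, expansion (fun n => Psi n x) c.
Proof.
have [N hN] := conil x; pose J := conv_id - 1.
have J1 : J 1 = 0 by rewrite convD convN conv1 counit1 scale1r subrr.
have Jx i : (N <= i)%N -> (J ^+ i) x = 0 by apply: hN.
have PsiE n : Psi n x = \sum_(i < N) 'C(n, i)%:R *: (J ^+ i) x.
  have -> : conv_id = J + 1 by rewrite subrK.
  rewrite exprD1n conv_sum.
  under eq_bigr do rewrite convMn -(scaler_nat (R := k)).
  pose c i := 'C(n, i)%:R *: (J ^+ i) x.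
  have sumE M : \sum_(i < M) c i = \sum_(i < M) 1 *: c i.
    by apply: eq_bigr => i _; rewrite scale1r.
  rewrite [LHS](sumE n.+1) [RHS](sumE N).
  rewrite (sum_widen (fun=> 1) _ (leq_maxl n.+1 N)); last first.
    by move=> i ni; rewrite /c bin_small // scale0r.
  rewrite (sum_widen (fun=> 1) _ (leq_maxr n.+1 N)) // => i Ni.
  by rewrite /c Jx // scaler0.
have /choice[c hc] := fun i => expansion_binomial ((J ^+ i) x) i.
exists (fun j => \sum_(i < N) c i j).
apply: eq_expansion (expansion_sum (index_enum 'I_N) (fun i : 'I_N => hc i)) => n //.
Qed.

(** The coefficients are chosen separately at each x; their uniqueness makes
    them linear in x. *)
Definition adams_coef_fun i x := sval (cid (adams_expansion_exists x)) i.

Lemma adams_coef_funP x :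
  expansion (fun n => Psi n x) (fun i => adams_coef_fun i x).
Proof. exact: svalP (cid (adams_expansion_exists x)). Qed.

Lemma adams_coef_subproof i : linear (adams_coef_fun i).
Proof.
move=> a x y; have hxy := expansion_lin a (adams_coef_funP x) (adams_coef_funP y).
apply: (expansion_uniq char0 (adams_coef_funP _) hxy) => n.
exact: conv_linear.
Qed.

Definition adams_coef i : conv H H := Conv (adams_coef_subproof i).

Arguments adams_coef : simpl never.

Lemma adams_coefP x : expansion (fun n => Psi n x) (fun i => adams_coef i x).
Proof. exact: adams_coef_funP. Qed.

Lemma adams_coef0 : adams_coef 0%N = 1.
Proof. by apply: eq_conv => x; rewrite -(expansion_at0 (adams_coefP x)). Qed.

(** In the convolution ring Hom(H, H (x) H) the coproduct is the product of
    a |-> a (x) 1 and a |-> 1 (x) a, which commute because H is cocommutative;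
    hence its n-th power is the product of theirs. *)
Lemma adams_comul n x : comul (Psi n x) = tmap (Psi n) (Psi n) (comul x).
Proof.
have l1 := @tpure_linear_left k H H 1; have l2 := @tpure_linear_right k H H 1.
have m1 : {morph (fun a : H => a \ox (1 : H)) : x y / x * y}.
  by move=> a b; rewrite tpureM mulr1.
have m2 : {morph (fun a : H => (1 : H) \ox a) : x y / x * y}.
  by move=> a b; rewrite tpureM mulr1.
have cl := @comul_linear k H.
pose i1 := conv_post l1 conv_id; pose i2 := conv_post l2 conv_id.
have hb (p q : conv H (tensor H H)) :=
  mul_bilinear (@conv_linear _ _ _ p) (@conv_linear _ _ _ q).
have i12 : i1 * i2 = conv_post cl conv_id.
  apply: eq_conv => z; rewrite convM /=.
  apply: (linear_eq_tensor (tlift_linear (hb i1 i2)) (@id_linear _ _)) => a b.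
  by rewrite (tlift_pure (hb i1 i2)) /= tpureM mulr1 mul1r.
have i21 : i2 * i1 = conv_post cl conv_id.
  apply: eq_conv => z; rewrite convM /= -[RHS]cocomm.
  apply: (linear_eq_tensor (tlift_linear (hb i2 i1)) (@tswap_linear k H H)) => a b.
  by rewrite (tlift_pure (hb i2 i1)) /= tpureM mulr1 mul1r tswap_pure.
have -> : comul (Psi n x) = (conv_post cl conv_id ^+ n) x.
  by rewrite -(conv_postX cl (@comul1 k H) (@comulM k H)).
rewrite -i12 exprMn_comm; last by rewrite /GRing.comm i12 i21.
rewrite -(conv_postX l1 (erefl _) m1) -(conv_postX l2 (erefl _) m2) convM.
have hl := @conv_linear _ _ _ (Psi n).
apply: (linear_eq_tensor (tlift_linear (hb _ _)) (tmap_linear hl hl)) => a b.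
by rewrite (tlift_pure (hb _ _)) /= tpureM mulr1 mul1r tmap_pure.
Qed.

(** The first Eulerian idempotent, that is, the convolution logarithm of id:
    the derivative of Psi^n at n = 0. *)
Definition eulerian := adams_coef 1%N.

Arguments eulerian : simpl never.

(** Compare the coefficients of n in Delta Psi^n = (Psi^n (x) Psi^n) Delta,
    using e_0 = 1: Delta e = (e (x) e_0 + e_0 (x) e) Delta. *)
Lemma eulerian_primitive x : eulerian x \in primitive.
Proof.
apply/primitiveP; have [n [a [b E]]] := comul_sum x.
have h1 := expansion_linear (@comul_linear k H) (adams_coefP x).
have h2 := expansion_sum (index_enum 'I_n) (fun i : 'I_n =>
  expansion_bilinear (@tpure_bilinear k H H)
    (adams_coefP (a i)) (adams_coefP (b i))).
rewrite -[LHS]/((comul \o (fun i => adams_coef i x)) 1%N).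
rewrite (expansion_uniq char0 h1 h2); last first.
  move=> m; rewrite /= adams_comul E.
  have hl := @conv_linear _ _ _ (Psi m).
  rewrite (lin_sum _ _ _ (tmap_linear hl hl)).
  by apply: eq_bigr => i _; rewrite tmap_pure.
have {}E : comul x = 0 \ox 0 + \sum_i a i \ox b i by rewrite tpure0l add0r.
have Er : x = \sum_i counit (b i) *: a i.
  by rewrite -[LHS]act_counit (actE (@counit_linear k H) E) scaler0 add0r.
have El : x = \sum_i counit (a i) *: b i.
  rewrite -[LHS]act_counit (act_swapE cocomm (@counit_linear k H) E).
  by rewrite scaler0 add0r.
have eL := @conv_linear _ _ _ eulerian.
rewrite [X in _ = eulerian X \ox _ + _]Er [X in _ = _ + _ \ox eulerian X]El.
rewrite !(lin_sum _ _ _ eL) (lin_sum _ _ _ (@tpure_linear_left k H H 1)).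
rewrite (lin_sum _ _ _ (@tpure_linear_right k H H 1)) -big_split.
have two (V : lmodType k) (F : nat -> V) : \sum_(l < 2) F l = F 0%N + F 1%N.
  by rewrite big_ord_recr big_ord1.
apply: eq_bigr => i _.
rewrite (two _ (fun l => adams_coef l (a i) \ox adams_coef (1 - l) (b i))).
rewrite subn0 subnn adams_coef0 !conv1.
by rewrite !(linZ eL) !tpureZl !tpureZr addrC.
Qed.

(** By induction on m, as sum_i C(n, i) c^(n-i) m^i c^i = (m+1)^n c^n. *)
Lemma adams_primitiveX c n m : c \in primitive ->
  Psi m (c ^+ n) = m%:R ^+ n *: c ^+ n.
Proof.
move=> hc; elim: m n => [|m IH] n.
  rewrite conv1 expr0n; case: n => [|n]; first by rewrite counit1.
  by rewrite exprS counitM (counit_primitive hc) mul0r !scale0r.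
have hb := mul_bilinear (@conv_linear _ _ _ conv_id) (@conv_linear _ _ _ (Psi m)).
rewrite exprS convM (comul_primitiveX hc) (tlift_sum _ _ hb).
rewrite -[m.+1]addn1 natrD addrC exprDn scaler_suml; apply: eq_bigr => i _.
rewrite -(scaler_nat (R := k)) (linZ (@conv_linear _ _ _ _)) IH -!scalerAr.
by rewrite -exprD subnK ?leq_ord // expr1n mul1r scalerA mulr_natl.
Qed.

Lemma eulerian_primitiveX c n : c \in primitive ->
  eulerian (c ^+ n) = if n == 1%N then c else 0.
Proof.
move=> hc; have := expansion_uniq char0 (adams_coefP (c ^+ n))
  (expansion_power (c ^+ n) n) (fun m => adams_primitiveX n m hc) 1%N.
rewrite -/eulerian => /= ->.
rewrite eq_sym; case: eqP => [->|_]; first by rewrite scale1r.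
by rewrite scale0r.
Qed.

Lemma expansion_translate (V : lmodType k) (v : V) j m :
  expansion (fun n => (n + m)%:R ^+ j *: v)
            (fun i => (m%:R ^+ (j - i) *+ 'C(j, i)) *: v).
Proof.
exists j.+1; split=> [i ji|n]; first by rewrite bin_small // mulr0n scale0r.
rewrite natrD addrC exprDn scaler_suml; apply: eq_bigr => i _.
by rewrite scalerA mulrnAr mulrC.
Qed.

(** The coefficient of n in Psi^(n+m) = Psi^n * Psi^m is the differential
    equation e * Psi^m = d/dm Psi^m; comparing coefficients of m^j gives the
    claim. *)
Lemma eulerian_mul j : eulerian * adams_coef j = adams_coef j.+1 *+ j.+1.
Proof.
apply: eq_conv => x; rewrite convMn; have [l [a [b E]]] := comul_sum x.
have hb (p q : conv H H) :=
  mul_bilinear (@conv_linear _ _ _ p) (@conv_linear _ _ _ q).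
have mulE (p q : conv H H) : (p * q) x = \sum_i p (a i) * q (b i).
  by rewrite convM E (tlift_sum _ _ (hb p q)).
have [N [c0 xE]] := adams_coefP x.
have derivative m : (eulerian * Psi m) x =
    \sum_(i < N) m%:R ^+ i *: (adams_coef i.+1 x *+ i.+1).
  have h1 := expansion_sum (index_enum 'I_l) (fun i : 'I_l => expansion_linear
    ((@mulr_bilinear k H).1 (Psi m (b i))) (adams_coefP (a i))).
  have h2 := expansion_sum (index_enum 'I_N) (fun i : 'I_N =>
    expansion_translate (adams_coef i x) i m).
  rewrite mulE.
  have h12 n : \sum_(i < l) Psi n (a i) * Psi m (b i) =
      \sum_(i < N) (n + m)%:R ^+ i *: adams_coef i x.
    by rewrite -xE -mulE -exprD.
  have e1 := expansion_uniq char0 h1 h2 h12 1%N.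
  apply: etrans e1 _.
  have term i : (m%:R ^+ (i - 1) *+ 'C(i, 1)) *: adams_coef i x =
      m%:R ^+ i.-1 *: (adams_coef i x *+ i).
    by rewrite bin1 subn1 -scalerMnl scalerMnr.
  under eq_bigr do rewrite term.
  case: N c0 {xE h2 h12} => [|N] c0.
    by rewrite !big_ord0.
  rewrite big_ord_recl mulr0n scaler0 add0r big_ord_recr c0 //.
  by rewrite mul0rn scaler0; symmetry; apply: addr0.
have h1 := expansion_sum (index_enum 'I_l) (fun i : 'I_l => expansion_linear
  ((@mulr_bilinear k H).2 (eulerian (a i))) (adams_coefP (b i))).
have h2 : expansion (fun m => (eulerian * Psi m) x)
    (fun i => adams_coef i.+1 x *+ i.+1).
  exists N; split=> [i Ni|//]; rewrite c0 ?mul0rn //; exact: leqW.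
by rewrite mulE; apply: (expansion_uniq char0 h1 h2) => m; rewrite mulE.
Qed.

Lemma eulerian_exp j : eulerian ^+ j = adams_coef j *+ j`!.
Proof.
elim: j => [|j IH]; first by rewrite adams_coef0 mulr1n.
by rewrite exprS IH mulrnAr eulerian_mul -mulrnA -factS.
Qed.

Lemma eulerian1 : eulerian 1 = 0.
Proof.
by have := @eulerian_primitiveX 0 0 (rpred0 _); rewrite expr0.
Qed.

Section ConvolutionExponential.
Variables (A : algType k) (f : conv H A).
Hypothesis f1 : f 1 = 0.

(** The exponential series sum_i f^i / i! of the convolution ring, which is a
    finite sum at each x. *)
Definition conv_exp_fun x : A :=
  \sum_(i < sval (cid (conil x))) i`!%:R^-1 *: (f ^+ i) x.

Lemma conv_exp_funE x N : conilpotent_at x N ->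
  conv_exp_fun x = \sum_(i < N) i`!%:R^-1 *: (f ^+ i) x.
Proof.
move=> xN; rewrite /conv_exp_fun; case: cid => M xM /=.
have zM i : (M <= i)%N -> (f ^+ i) x = 0 by apply: xM.
have zN i : (N <= i)%N -> (f ^+ i) x = 0 by apply: xN.
rewrite (sum_widen (fun i => i`!%:R^-1) zM (leq_maxl M N)).
by rewrite (sum_widen (fun i => i`!%:R^-1) zN (leq_maxr M N)).
Qed.

Lemma conv_exp_subproof : linear conv_exp_fun.
Proof.
move=> a x y; have [N xN] := conil x; have [M yM] := conil y.
have [L xyL] := conil (a *: x + y).
have up (z : H) K K' : (K <= K')%N -> conilpotent_at z K -> conilpotent_at z K'.
  by move=> le h B J J1 n le'; apply: h => //; apply: leq_trans le'.
pose K := maxn (maxn N M) L.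
have NK : (N <= K)%N by rewrite /K -maxnA leq_maxl.
have MK : (M <= K)%N by rewrite /K maxnAC leq_maxr.
have LK : (L <= K)%N by rewrite leq_maxr.
rewrite (conv_exp_funE (up _ _ _ NK xN)) /=.
rewrite (conv_exp_funE (up _ _ _ MK yM)).
rewrite (conv_exp_funE (up _ _ _ LK xyL)).
rewrite scaler_sumr -big_split.
apply: eq_bigr => i _ /=.
by rewrite (@conv_linear _ _ _ (f ^+ i)) scalerDr !scalerA mulrC.
Qed.

Definition conv_exp : conv H A := Conv conv_exp_subproof.

Lemma conv_expE x : exists N, forall M, (N <= M)%N ->
  conv_exp x = \sum_(i < M) i`!%:R^-1 *: (f ^+ i) x.
Proof.
have [N xN] := conil x; exists N => M NM; apply: conv_exp_funE => B J J1 n Mn.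
by apply: xN => //; apply: leq_trans Mn.
Qed.

Lemma conv_exp_primitiveX c u n : c \in primitive ->
  (forall m, f (c ^+ m) = if m == 1%N then u else 0) ->
  conv_exp (c ^+ n) = u ^+ n.
Proof.
move=> hc fc; have [N /(_ (maxn N n.+1) (leq_maxl _ _)) ->] := conv_expE (c ^+ n).
under eq_bigr do rewrite (conv_primitiveX hc _ _ fc).
have nN : (n < maxn N n.+1)%N by rewrite leq_maxr.
rewrite (bigD1 (Ordinal nN)) //= eqxx big1 ?addr0 => [|i].
  rewrite -(scaler_nat (R := k)) scalerA mulVf ?scale1r //.
  by have := fact_gt0 n; case: n`! => // m _; apply: pnatr_neq0.
by rewrite -val_eqE /= => /negbTE ->; rewrite scaler0.
Qed.

End ConvolutionExponential.

(** As e_i = e^i / i!, this is Psi^1(x) = sum_i e_i(x). *)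
Lemma conv_exp_eulerian x : conv_exp eulerian1 x = x.
Proof.
have [N e] := conv_expE eulerian1 x; have [M [c0 xE]] := adams_coefP x.
rewrite (e (maxn N M) (leq_maxl _ _)).
transitivity (Psi 1 x); last by rewrite expr1.
rewrite xE (sum_widen _ c0 (leq_maxr N M)); apply: eq_bigr => i _.
rewrite eulerian_exp convMn -(scaler_nat (R := k)) scalerA expr1n mulVf //.
by have := fact_gt0 i; case: (_`!) => // m _; apply: pnatr_neq0.
Qed.

End AdamsOperations.

Lemma conv_exp_post (k : fieldType) (H : bialgType k)
    (conil : conilpotent H) (A B : algType k)
    (f : A -> B) (f_lin : linear f) (u : conv H A) (v : conv H B)
    (u1 : u 1 = 0) (v1 : v 1 = 0) x :
  f 1 = 1 -> {morph f : x y / x * y} -> (forall y, f (u y) = v y) ->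
  f (conv_exp conil u1 x) = conv_exp conil v1 x.
Proof.
move=> f1 fM fu.
have [N eN] := conv_expE conil u1 x; have [M eM] := conv_expE conil v1 x.
rewrite (eN _ (leq_maxl N M)) (eM _ (leq_maxr N M)) (lin_sum _ _ _ f_lin).
have -> : v = conv_post f_lin u by apply: eq_conv => y; rewrite -fu.
by apply: eq_bigr => i _; rewrite (linZ f_lin) -(conv_postX f_lin f1 fM).
Qed.

(** * The enveloping algebra is spanned by powers *)

Section SymmetricPowers.
Variables (k : fieldType) (g : lieAlgType k).
Hypothesis char0 : [pchar k] =i pred0.
Notation U := (uenv g).

Lemma expansion_exp (X Y : U) n : exists c,
  [/\ expansion (fun t => (X + t%:R *: Y) ^+ n) c, c 0%N = X ^+ n &
      c 1%N = \sum_(i < n) X ^+ i * Y * X ^+ (n.-1 - i)].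
Proof.
have hXY := expansionD (expansion_power X 0%N) (expansion_power Y 1%N).
elim: n => [|n [c [hc c0 c1]]].
  exists (fun i => (i == 0)%N%:R *: 1); split; last by rewrite big_ord0 scale0r.
    by apply: eq_expansion (expansion_cst (1 : U)) => t; rewrite ?expr0.
  by rewrite scale1r.
have h := expansion_bilinear (@mulr_bilinear k U) hXY hc.
exists (fun r => \sum_(i < r.+1)
  ((val i == 0)%N%:R *: X + (val i == 1)%N%:R *: Y) * c (r - i)%N); split.
- apply: eq_expansion h => [t|r]; last by [].
  by rewrite [RHS]exprS expr0 scale1r expr1.
- by rewrite big_ord1 /= scale1r scale0r addr0 subn0 c0 exprS.
rewrite big_ord_recr big_ord1 /= !scale1r !scale0r addr0 add0r subn0 subnn c0 c1.
rewrite [RHS]big_ord_recl expr0 mul1r subn0 addrC mulr_sumr; congr (_ + _).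
apply: eq_bigr => i _.
by rewrite lift0 exprS !mulrA -[n.-1]subn1 -subnDA add1n.
Qed.

Definition power_upto n (u : U) := exists x m, (m <= n)%N /\ u = ugen x ^+ m.

Lemma power_upto_leq m n u :
  (m <= n)%N -> span (power_upto m) u -> span (power_upto n) u.
Proof.
move=> mn; apply: span_min; first exact: span_closed.
move=> _ [x [i [im ->]]]; apply: span_gen; exists x, i; split=> //.
exact: leq_trans mn.
Qed.

(** Polarization.  Modulo products of at most n generators, which are known to
    lie in the span, the monomials x^i y x^(m-i) with m <= n are all equal to
    y x^m.  Their sum over i is the coefficient of t in (x + ty)^(m+1).  That
    coefficient lies in the span of the values at t = 0, 1, 2, ..., and m + 1
    is invertible. *)
Lemma monomial_span_powers n (s : seq g) : (size s <= n)%N ->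
  span (power_upto n) (\prod_(x <- s) ugen x).
Proof.
elim: n s => [|n IH] s sn.
  case: s sn => // _; rewrite big_nil; apply: span_gen.
  by exists 0, 0%N; rewrite expr0.
case: s sn => [_|y s sn].
  rewrite big_nil; apply: span_gen.
  by exists 0, 0%N; rewrite expr0.
rewrite big_cons; set S := span (power_upto n.+1).
have hS : lin_closed S by apply: span_closed.
move: (\prod_(x <- s) _) (IH s sn) => u.
apply: (@span_min k U (power_upto n) (fun u => S (ugen y * u))).
  split=> [|a v w hv hw]; first by rewrite mulr0; apply: hS.1.
  by rewrite mulrDr -scalerAr; apply: hS.2.
move=> _ [x [m [mn ->]]].
pose Z i := ugen x ^+ i * ugen y * ugen x ^+ (m - i).
have diff i : (i <= m)%N -> S (ugen y * ugen x ^+ m - Z i).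
  elim: i => [_|i IHi im].
    by rewrite /Z expr0 mul1r subn0 subrr; apply: hS.1.
  have -> : ugen y * ugen x ^+ m - Z i.+1 =
      (ugen y * ugen x ^+ m - Z i) + (Z i - Z i.+1) by rewrite addrA subrK.
  apply: (lin_closedD hS); first by apply: IHi; apply: ltnW.
  have -> : Z i - Z i.+1 =
      \prod_(z <- nseq i x ++ lie y x :: nseq (m - i.+1) x) ugen z.
    rewrite big_cat big_cons /= !big_nseq !iter_mulr_1 ugen_lie /Z.
    rewrite -(subnSK im) (exprS _ (m - i.+1)) (exprSr _ i) mulrBl mulrBr.
    by rewrite !mulrA.
  apply: (power_upto_leq (leqnSn n)); apply: IH.
  by rewrite size_cat /= !size_nseq subnSK // subnKC // ltnW.
have sym : S (\sum_(i < m.+1) Z i).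
  have [c [hc _ c1]] := expansion_exp (ugen x) (ugen y) m.+1.
  have <- : c 1%N = \sum_(i < m.+1) Z i by [].
  apply: (expansion_mem char0 hS hc) => t; apply: span_gen.
  by exists (x + t%:R *: y), m.+1; rewrite ugenD ugenZ.
rewrite -[_ * _](scalerK (a := m.+1%:R : k)); last first.
  by have /pcharf0P -> := char0.
apply: (lin_closedZ hS).
have -> : m.+1%:R *: (ugen y * ugen x ^+ m) =
   \sum_(i < m.+1) (ugen y * ugen x ^+ m - Z i) + \sum_(i < m.+1) Z i.
  by rewrite -big_split /= (eq_bigr _ (fun i _ => subrK _ _)) sumr_const card_ord
    scaler_nat.
apply: (lin_closedD hS) => //; apply: (lin_closed_sum hS) => i _.
by apply: diff; rewrite -ltnS.
Qed.

Lemma uenv_span_powers (u : U) : span (fun v => exists x n, v = ugen x ^+ n) u.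
Proof.
pose M (v : U) := exists s : seq g, v = \prod_(x <- s) ugen x.
have hM : lin_closed (span M) by apply: span_closed.
have : span M u.
  suff h w : span M w -> span M (u * w).
    by rewrite -[u]mulr1; apply: h; apply: span_gen; exists [::]; rewrite big_nil.
  elim/uenv_ind: u w => [x|a|u v IHu IHv|u v IHu IHv] w hw.
  - move: w hw; apply: (@span_min k U M (fun w => span M (ugen x * w))).
      split=> [|a v w hv hw]; first by rewrite mulr0; apply: hM.1.
      by rewrite mulrDr -scalerAr; apply: hM.2.
    by move=> _ [s ->]; apply: span_gen; exists (x :: s); rewrite big_cons.
  - by rewrite -scalerAl mul1r; apply: (lin_closedZ hM).
  - by rewrite mulrDl; apply: (lin_closedD hM); [apply: IHu|apply: IHv].
  - by rewrite -mulrA; apply: IHu; apply: IHv.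
apply: span_min; first exact: span_closed.
move=> _ [s ->]; apply: span_min (monomial_span_powers (leqnn (size s))).
  exact: span_closed.
by move=> _ [x [m [_ ->]]]; apply: span_gen; exists x, m.
Qed.

End SymmetricPowers.

(** * The canonical map from the enveloping algebra of the primitives *)

Section CanonicalMap.
Variables (k : fieldType) (H : hopfAlgType k).
Notation g := (prim H).
Notation U := (uenv g).

Definition prim_envelope_map : U -> H := ulift (fun a : k => a%:A : H) (@prim_val k H).
Notation phi := prim_envelope_map.

Let scD : {morph (fun a : k => a%:A : H) : a b / a + b}.
Proof. by move=> a b; apply: scalerDl. Qed.
Let scM : {morph (fun a : k => a%:A : H) : a b / a * b}.
Proof. by move=> a b; rewrite -scalerAl mul1r scalerA. Qed.
Let sc1 : (1%:A : H) = 1. Proof. exact: scale1r. Qed.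
Let scC (a : k) (x : H) : (a%:A : H) * x = x * a%:A.
Proof. by rewrite -scalerAl -scalerAr mul1r mulr1. Qed.
Let fD : {morph @prim_val k H : x y / x + y}.
Proof. exact: linD (@prim_val_linear k H). Qed.
Let fZ (a : k) (x : g) : prim_val (a *: x) = a%:A * prim_val x.
Proof. by rewrite (linZ (@prim_val_linear k H)) -scalerAl mul1r. Qed.
Let fL (x y : g) :
  prim_val (lie x y) = prim_val x * prim_val y - prim_val y * prim_val x.
Proof. by []. Qed.

Lemma prim_envelope_mapD : {morph phi : u v / u + v}.
Proof. exact: uliftD scD scM sc1 scC fD fZ fL. Qed.
Lemma prim_envelope_mapM : {morph phi : u v / u * v}.
Proof. exact: uliftM scD scM sc1 scC fD fZ fL. Qed.
Lemma prim_envelope_map_gen x : phi (ugen x) = prim_val x.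
Proof. exact: ulift_gen scD scM sc1 scC fD fZ fL x. Qed.
Lemma prim_envelope_map1 : phi 1 = 1.
Proof. exact: ulift1 scD scM sc1 scC fD fZ fL. Qed.
Lemma prim_envelope_map_linear : linear phi.
Proof.
move=> a u v; rewrite prim_envelope_mapD [phi (_ *: _)](uliftZ scD scM sc1 scC fD fZ fL).
by rewrite -scalerAl mul1r.
Qed.

Lemma prim_envelope_map_coalgebra : coalgebra_hom phi.
Proof.
have pL := prim_envelope_map_linear; have tL := tmap_linear pL pL.
have mb := @mulr_bilinear k; split=> // u.
  elim/uenv_ind: u => [x|a|u v IHu IHv|u v IHu IHv].
  - rewrite prim_envelope_map_gen prim_comul [comul (ugen x)]ucomul_gen.
    by rewrite (linD tL) !tmap_pure // prim_envelope_map_gen prim_envelope_map1.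
  - rewrite (linZ pL) prim_envelope_map1 !(linZ (@comul_linear k _)) (linZ tL).
    by rewrite !comul1 !tensor_oneE tmap_pure // prim_envelope_map1.
  - rewrite prim_envelope_mapD !(linD (@comul_linear k _)) (linD tL).
    by rewrite IHu IHv.
  rewrite prim_envelope_mapM !comulM IHu IHv tensor_mulE.
  by rewrite (tmap_tmul _ _ (mb _) (mb _) (mb _) (mb _) pL pL
    prim_envelope_mapM prim_envelope_mapM).
elim/uenv_ind: u => [x|a|u v IHu IHv|u v IHu IHv].
- by rewrite prim_envelope_map_gen [RHS]ucounit_gen counit_primitive //; case: x.
- by rewrite (linZ pL) prim_envelope_map1 !(scalarZ (@counit_linear k _)) !counit1.
- have cD (C : coalgType k) := @linD k C k^o counit (@counit_linear k C).
  by rewrite prim_envelope_mapD (cD H) IHu IHv; symmetry; apply: (cD U).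
by rewrite prim_envelope_mapM !counitM IHu IHv.
Qed.

End CanonicalMap.

Section BialgebraMaps.
Variables (k : fieldType) (H K : hopfAlgType k) (f : H -> K).
Hypotheses (hf : coalgebra_hom f) (f1 : f 1 = 1) (fM : {morph f : x y / x * y}).

(** In the convolution ring Hom(H, K), f S and S f are a left and a right
    inverse of f, so they agree. *)
Lemma bialgebra_hom_antipode : {morph f : x / antipode x}.
Proof.
have [f_lin fcomul fcounit] := hf.
pose F : conv H K := Conv f_lin.
pose L : conv H K := Conv (linear_comp (@antipode_linear k H) f_lin).
pose R : conv H K := Conv (linear_comp f_lin (@antipode_linear k K)).
have LF : L * F = 1.
  apply: eq_conv => x; rewrite convM conv1.
  have bl := mul_bilinear (@antipode_linear k H) (@id_linear k H).
  rewrite -f1 -(linZ f_lin) -antipodel.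
  have bLF := mul_bilinear (@conv_linear _ _ _ L) f_lin.
  apply: (linear_eq_tensor (tlift_linear bLF)
    (linear_comp (tlift_linear bl) f_lin)) => a b.
  by rewrite (tlift_pure bLF) (tlift_pure bl) fM.
have FR : F * R = 1.
  apply: eq_conv => x; rewrite convM conv1.
  have br := mul_bilinear (@id_linear k K) (@antipode_linear k K).
  rewrite -fcounit -antipoder fcomul.
  have bFR := mul_bilinear f_lin (@conv_linear _ _ _ R).
  apply: (linear_eq_tensor (tlift_linear bFR)
    (linear_comp (tmap_linear f_lin f_lin) (tlift_linear br))) => a b.
  by rewrite (tlift_pure bFR) tmap_pure // (tlift_pure br).
move=> x; have e : L = R by rewrite -[L]mulr1 -FR mulrA LF mul1r.
exact: (congr1 (fun h : conv H K => h x) e).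
Qed.

End BialgebraMaps.

Section CartierMilnorMoore.
Variables (k : fieldType) (H : hopfAlgType k).
Hypotheses (char0 : [pchar k] =i pred0).
Hypotheses (cocomm : cocommutative H) (conn : connected H).
Notation U := (uenv (prim H)).
Notation phi := (@prim_envelope_map k H).

Let conil : conilpotent H := connected_conilpotent cocomm conn.

Definition eulerian_prim x : prim H := Prim (eulerian_primitive char0 cocomm conil x).

Lemma eulerian_ugen_linear : linear (fun x => ugen (eulerian_prim x)).
Proof.
move=> a x y; rewrite -ugen_linear; congr ugen; apply: val_inj.
exact: conv_linear.
Qed.

Definition eulerian_ugen : conv H U := Conv eulerian_ugen_linear.

Lemma eulerian_ugen_primitiveX (c : prim H) n :
  eulerian_ugen (prim_val c ^+ n) = if n == 1%N then ugen c else 0.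
Proof.
have hc : prim_val c \in primitive by case: c.
rewrite -(lin0 (@ugen_linear k (prim H))) -fun_if; congr ugen; apply: val_inj.
apply: etrans (eulerian_primitiveX char0 conil n hc) _.
by case: ifP.
Qed.

Lemma eulerian_ugen1 : eulerian_ugen 1 = 0.
Proof. by have := eulerian_ugen_primitiveX 0 0; rewrite expr0. Qed.

(** The inverse of phi: since id = exp(e) on H, it is the convolution
    exponential of e with values moved to the generators of U(P(H)). *)
Definition envelope_section : H -> U := conv_exp conil eulerian_ugen1.

Lemma envelope_sectionK : cancel envelope_section phi.
Proof.
move=> x; have phiL := @prim_envelope_map_linear k H.
have e1 := eulerian1 char0 conil.
rewrite -[RHS](conv_exp_eulerian char0 conil).
apply: (conv_exp_post conil phiL eulerian_ugen1 (eulerian1 char0 conil)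
  x (@prim_envelope_map1 k H) (@prim_envelope_mapM k H)).
by move=> y; rewrite prim_envelope_map_gen.
Qed.

(** The exponential sends c^n to the n-th power of the generator of c, and such
    powers span U(P(H)). *)
Lemma prim_envelope_mapK : cancel phi envelope_section.
Proof.
move=> u; have := uenv_span_powers char0 u.
apply: (@span_min k U _ (fun u => envelope_section (phi u) = u)).
  have phiL := @prim_envelope_map_linear k H.
  have sL : linear envelope_section by apply: conv_linear.
  split=> [|a v w hv hw]; first by rewrite (lin0 phiL) (lin0 sL).
  by rewrite phiL sL hv hw.
move=> _ [c [n ->]].
have -> : phi (ugen c ^+ n) = prim_val c ^+ n.
  elim: n => [|n IH]; first exact: prim_envelope_map1.
  by rewrite !exprS prim_envelope_mapM IH prim_envelope_map_gen.
apply: conv_exp_primitiveX => //; first by case: c.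
exact: eulerian_ugen_primitiveX.
Qed.

Theorem cartier_milnor_moore : hopf_isomorphism phi.
Proof.
split; last first.
  by exists envelope_section;
    [apply: prim_envelope_mapK|apply: envelope_sectionK].
have hC := @prim_envelope_map_coalgebra k H.
split=> //; first exact: prim_envelope_map1.
  exact: prim_envelope_mapM.
apply: bialgebra_hom_antipode => //; first exact: prim_envelope_map1.
exact: prim_envelope_mapM.
Qed.

End CartierMilnorMoore.

(** * Difference operators *)

Section DifferenceOperators.
Variables (k : fieldType) (H : hopfAlgType k).

Lemma antipode_one : antipode (1 : H) = 1.
Proof.
have hb := mul_bilinear (@antipode_linear k H) (@id_linear k H).
have := antipodel (1 : H); rewrite comul1 tensor_oneE (tlift_pure hb) counit1.
by rewrite mulr1 scale1r.
Qed.

Lemma antipode_primitive (c : H) : c \in primitive -> antipode c = - c.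
Proof.
move=> hc; have hb := mul_bilinear (@antipode_linear k H) (@id_linear k H).
have := antipodel c; rewrite (primitiveP _ hc) (tliftD hb) !(tlift_pure hb).
rewrite antipode_one mulr1 mul1r (counit_primitive hc) scale0r => /eqP.
by rewrite addr_eq0 => /eqP.
Qed.

(** Here (Delta (x) id) Delta(c) = c (x) 1 (x) 1 + 1 (x) c (x) 1 + 1 (x) 1 (x) c,
    D(1) = 1 and S(c) = -c. *)
Lemma difference_operator_primitiveM (D : H -> H) (c y : H) :
  difference_operator D -> c \in primitive ->
  D (c * y) = D c * D y + c * D y - D y * c.
Proof.
move=> hD hc; have D1 := difference_operator1 hD; have [[D_lin _ _] DM] := hD.
have bil z : bilinear_for *:%R *:%R (fun x1 x2 : H => D x1 * x2 * D y * antipode z).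
  apply: bilinI => [w a u v|w a u v] /=.
    by rewrite D_lin !mulrDl -!scalerAl.
  by rewrite mulrDr !mulrDl -scalerAr -!scalerAl.
have bil2 : bilinear_for *:%R *:%R (fun (x12 : tensor H H) (x3 : H) =>
    tlift (fun x1 x2 => D x1 * x2 * D y * antipode x3) x12).
  apply: bilinI => [w|w a u v]; first exact/tlift_linear/bil.
  by apply: tlift_comb => u' v'; rewrite antipode_linear mulrDr scalerAr.
have tL := tmap_linear (@comul_linear k H) (@id_linear k H).
rewrite DM (primitiveP _ hc) (linD tL) !tmap_pure //; try exact: comul_linear.
rewrite (primitiveP _ hc) comul1 tensor_oneE (tliftD bil2) !(tlift_pure bil2).
rewrite (tliftD (bil 1)) !(tlift_pure (bil _)) antipode_one.
by rewrite antipode_primitive // D1 !mulr1 !mul1r mulrN.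
Qed.

End DifferenceOperators.

Theorem corollary2p9 (k : fieldType) (char0 : [pchar k] =i pred0)
    (H : hopfAlgType k) (Hcocomm : cocommutative H) (Hconn : connected H)
    (D : H -> H) (hD : difference_operator D)
    (Dbar : uenv (prim H) -> uenv (prim H))
    (hDbar : difference_operator Dbar)
    (Dbar_ext : forall c : prim H, Dbar (ugen c) = ugen (prim_restr hD c)) :
  exists phi : uenv (prim H) -> H,
    hopf_isomorphism phi /\ forall u, phi (Dbar u) = D (phi u).
Proof.
exists (@prim_envelope_map k H); split; first exact: cartier_milnor_moore.
set phi := @prim_envelope_map k H.
have phiL : linear phi := @prim_envelope_map_linear k H.
have phiM := @prim_envelope_mapM k H.
have [[D_lin _ _] _] := hD; have [[Db_lin _ _] _] := hDbar.
suff step u v : phi (Dbar v) = D (phi v) -> phi (Dbar (u * v)) = D (phi (u * v)).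
  move=> u; rewrite -[u]mulr1; apply: step.
  rewrite (difference_operator1 hDbar) /phi prim_envelope_map1.
  by rewrite (difference_operator1 hD).
(* Left multiplication by u, rather than u itself, is what the induction can
   split along products: a generator then always stands in front. *)
elim/uenv_ind: u v => [c|a|u w IHu IHw|u w IHu IHw] v hv.
- have ugen_prim : ugen c \in primitive by apply/primitiveP/ucomul_gen.
  rewrite (difference_operator_primitiveM _ hDbar ugen_prim) (linB phiL).
  rewrite (linD phiL) /phi !phiM Dbar_ext !prim_envelope_map_gen -/phi hv.
  by rewrite [RHS]difference_operator_primitiveM //; case: (c).
- by rewrite -scalerAl mul1r (linZ Db_lin) !(linZ phiL) (linZ D_lin) hv.
- by rewrite mulrDl (linD Db_lin) !(linD phiL) (linD D_lin) IHu // IHw.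
by rewrite -mulrA; apply: IHu; apply: IHw.
Qed.
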